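(* Let $\mathcal{A}$ be a locally finite hyperplane arrangement in $\mathbb{R}^n$, and let $\mathcal{M}$ be a Euclidean matching on $\mathrm{Sal}(\mathcal{A})$ with base point $x_0$. Then the associated Morse complex $\mathrm{Sal}(\mathcal{A})_{\mathcal{M}}$ is minimal (i.e., all the incidence numbers vanish).
   Context: Arrangements. $\mathcal{A}$ is a locally finite set of affine hyperplanes in $\mathbb{R}^n$. Faces are the closures of the strata of the induced stratification of $\mathbb{R}^n$ (two points are in the same stratum iff, for each $H\in\mathcal{A}$, both lie on $H$ or both lie strictly on the same side of $H$), ordered by $F\preceq G\iff F\supseteq G$; chambers are faces of codimension $0$, and $\mathcal{C}=\mathcal{C}(\mathcal{A})$ is the set of chambers. $s(C,C')\subseteq\mathcal{A}$ is the set of hyperplanes separating the chambers $C,C'$; the partial order $\leq_C$ on $\mathcal{C}$ is $D'\leq_C D\iff s(C,D')\subseteq s(C,D)$. $\mathcal{L}$ is the poset of flats ((nonempty) intersections of hyperplanes of $\mathcal{A}$, including $\mathbb{R}^n$). $\mathrm{supp}(F)=\{H\in\mathcal{A}\mid F\subseteq H\}$. For a chamber $C$ and a face $F$, $C.F$ is the unique chamber $C'\supseteq F$ with $\mathrm{supp}(F)\cap s(C,C')=\emptyset$. If $F\subseteq C$, $C^F$ is the chamber opposite to $C$ with respect to $F$, i.e. the unique chamber $C'\supseteq F$ with $s(C,C')=\mathrm{supp}(F)$. Salvetti complex. $\mathrm{Sal}(\mathcal{A})$ denotes the Salvetti complex, a regular CW complex, and also its poset of cells: there is a $k$-cell $\langle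 C,F\rangle$ for each chamber $C$ and face $F$ of $C$ of codimension $k$, and $\langle C,F\rangle<\langle D,G\rangle$ iff $F\prec G$ and $D.F=C$. For a chamber $C$, $S(C)=\{\langle C',F\rangle\mid C'=C.F\}$; given a total order $\dashv$ of $\mathcal{C}$, $N(C)$ is the set of cells of $S(C)$ not in any $S(C')$ with $C'\dashv C$; the sets $N(C)$ partition $\mathrm{Sal}(\mathcal{A})$. Matchings. For a ranked poset $P$, let $\mathcal{E}=\{(p,q)\mid q\lessdot p\}$. A matching is a subset $\mathcal{M}\subseteq\mathcal{E}$ such that every element of $P$ appears in at most one edge of $\mathcal{M}$; it is acyclic if the graph $G_\mathcal{M}$, in which $(p,q)\in\mathcal{E}$ is oriented from $p$ to $q$ when $(p,q)\notin\mathcal{M}$ and from $q$ to $p$ when $(p,q)\in\mathcal{M}$, has no directed cycle. Elements in no edge of $\mathcal{M}$ are critical. $\mathcal{M}$ is homogeneous with respect to a poset map $\varphi$ if $\varphi(p)=\varphi(q)$ for all $(p,q)\in\mathcal{M}$; it is proper if it is acyclic and homogeneous with respect to some poset map $\varphi\colon P\to Q$ with $\varphi^{-1}(Q_{\leq q})$ finite for all $q$. An alternating path is a directed path in $G_\mathcal{M}$ in which no two consecutive edges both belong to $\mathcal{M}$ or both to $\mathcal{E}\setminus\mathcal{M}$. Morse complex. If $\mathcal{M}$ is a proper acyclic matching on the poset of cells of a regular CW complex $X$, the Morse complex $X_\mathcal{M}$ is the CW complex, homotopy equivalent to $X$, given by discrete Morse theory; its cells are in dimension-preserving bijection $\sigma\mapsto\sigma_\mathcal{M}$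 with the critical cells of $X$. For critical cells with $\dim\sigma=\dim\tau+1$ its (integral) incidence number is $[\sigma_\mathcal{M}:\tau_\mathcal{M}]=\sum_\gamma m(\gamma)$, the sum being over all (finitely many) alternating paths $\gamma$ from $\sigma$ to $\tau$; for $\gamma$ of the form $\sigma=\sigma_0\searrow\tau_1\nearrow\sigma_1\searrow\dots\tau_k\nearrow\sigma_k\searrow\tau$, $m(\gamma)=(-1)^k[\sigma_k:\tau]\prod_{i=1}^k[\sigma_{i-1}:\tau_i][\sigma_i:\tau_i]$, with incidence numbers in $X$ on the right. Euclidean matchings. $d$ is the Euclidean distance and $\rho_K$ the projection onto a closed convex set $K$. A point $x$ is generic (with respect to $\mathcal{A}$) if: (i) for all $C,C'\in\mathcal{C}$ with $d(x,C)=d(x,C')$ we have $\rho_C(x)=\rho_{C'}(x)\in C\cap C'$; (ii) for all $L,L'\in\mathcal{L}$ with $L'\subsetneq L$ we have $d(x,L')>d(x,L)$. A total order $\dashv_{eu}$ on $\mathcal{C}$ is Euclidean with base point $x_0$ if $x_0$ is generic and $C\dashv_{eu}C'$ implies $d(x_0,C)\leq d(x_0,C')$. Given such an order, let $\eta\colon\mathrm{Sal}(\mathcal{A})\to\mathcal{C}\times\mathcal{C}$ be $\eta(\langle D,F\rangle)=(C,D^F)$, where $C$ is the chamber with $\langle D,F\rangle\in N(C)$; this is a poset map when $\mathcal{C}\times\mathcal{C}$ is ordered by the transitive closure of: $(C',E')\leq(C,E)$ iff ($C'=C$ or $C'\dashv_{eu}C$) and $E'\leq_C E$. An acyclic matching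 $\mathcal{M}$ on $\mathrm{Sal}(\mathcal{A})$ is a Euclidean matching with base point $x_0$ if: (i) $x_0$ is generic; (ii) $\mathcal{M}$ is homogeneous with respect to the map $\eta$ induced by a Euclidean order with base point $x_0$; (iii) there is exactly one critical cell $\langle C,F_C\rangle$ for every chamber $C$, where $F_C$ is the smallest face of $C$ containing $\rho_C(x_0)$. By (ii) a Euclidean matching is proper. *)

(* Defs.v *)
From HB Require Import structures.
From mathcomp Require Import all_boot all_order all_algebra.
From mathcomp Require Import all_classical all_reals all_analysis.

Set Implicit Arguments.
Unset Strict Implicit.
Unset Printing Implicit Defensive.

Import Order.TTheory GRing.Theory Num.Theory.
Import numFieldNormedType.Exports.

Local Open Scope classical_set_scope.
Local Open Scope ring_scope.

Section Matchings.
Context {P : choiceType}.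
Variable lt : P -> P -> Prop.

Definition covers (p q : P) : Prop :=
  lt q p /\ ~ exists r, lt q r /\ lt r p.

Definition hasse : set (P * P) := [set e | covers e.1 e.2].

Definition is_matching (M : set (P * P)) : Prop :=
  M `<=` hasse /\
  forall e e' p, M e -> M e' -> (p = e.1 \/ p = e.2) ->
    (p = e'.1 \/ p = e'.2) -> e = e'.

Definition matching_graph (M : set (P * P)) : rel P := fun x y =>
  `[< (hasse (x, y) /\ ~ M (x, y)) \/ (hasse (y, x) /\ M (y, x)) >].

Definition acyclic_matching (M : set (P * P)) : Prop :=
  is_matching M /\ forall s : seq P, cycle (matching_graph M) s -> s = [::].

Definition critical (M : set (P * P)) (p : P) : Prop :=
  forall e, M e -> p <> e.1 /\ p <> e.2.

Definition homogeneous {Q : Type} (phi : P -> Q) (M : set (P * P)) : Prop :=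
  forall p q, M (p, q) -> phi p = phi q.

Definition matched (M : set (P * P)) (x y : P) : bool :=
  `[< M (x, y) \/ M (y, x) >].

Fixpoint alternating (M : set (P * P)) (x : P) (s : seq P) : bool :=
  if s is y :: s' then
    (if s' is z :: _ then matched M x y != matched M y z else true)
    && alternating M y s'
  else true.

(* A path is encoded by its list of vertices after the starting point. *)
Definition alternating_paths (M : set (P * P)) (sigma tau : P) :
    set (seq P) :=
  [set s | [/\ path (matching_graph M) sigma s, last sigma s = tau
             & alternating M sigma s]].

(* Incidence functions of a regular CW complex with face poset [(P, lt)] and
   dimension function [dim].  The systems of incidence numbers obtained by
   orienting the cells of positive dimension are exactly the functions
   satisfying these axioms (Massey, A Basic Course in Algebraic Topology,
   Thm. IX.7.2). *)
Definition incidence_function (dim : P -> nat) (inc : P -> P -> int) : Prop :=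
  [/\ forall p q, ~ covers p q -> inc p q = 0,
      forall p q, covers p q -> inc p q = 1 \/ inc p q = -1,
      forall e v w, dim e = 1%N -> covers e v -> covers e w -> v <> w ->
        inc e v + inc e w = 0
    & forall p q q' r, covers p q -> covers q r -> covers p q' ->
        covers q' r -> q <> q' ->
        inc p q * inc q r + inc p q' * inc q' r = 0].

(* [m(gamma)] for [gamma] the path starting at [sigma] with remaining vertices
   [tau_1, sigma_1, ..., tau_k, sigma_k, tau]: every pair [tau_i, sigma_i]
   contributes [- [sigma_(i-1) : tau_i] [sigma_i : tau_i]] and the last step
   contributes [[sigma_k : tau]].  Lists of even length are not of this form;
   their value is irrelevant. *)
Fixpoint path_weight (inc : P -> P -> int) (sigma : P) (s : seq P) : int :=
  match s with
  | [::] => 0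
  | [:: tau] => inc sigma tau
  | tau1 :: sigma1 :: s' =>
      - (inc sigma tau1 * inc sigma1 tau1) * path_weight inc sigma1 s'
  end.

(* Only meaningful when [alternating_paths M sigma tau] is finite:
   [\sum_(i \in A) F i] is 0 by convention when [F] has infinite support
   in [A]. *)
Definition morse_incidence (inc : P -> P -> int) (M : set (P * P))
    (sigma tau : P) : int :=
  \sum_(gamma \in alternating_paths M sigma tau) path_weight inc sigma gamma.

(* Finiteness is what makes each incidence number a genuine sum. *)
Definition minimal_morse_complex (dim : P -> nat) (inc : P -> P -> int)
    (M : set (P * P)) : Prop :=
  forall sigma tau, critical M sigma -> critical M tau ->
    dim sigma = (dim tau).+1 ->
    finite_set (alternating_paths M sigma tau) /\
    morse_incidence inc M sigma tau = 0.

End Matchings.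

Section Euclidean.
Context {R : realType} {n : nat}.
Local Notation V := 'rV[R]_n.

Definition dotp (x y : V) : R := \sum_(i < n) x 0 i * y 0 i.

(* The norm of ['rV[R]_n] in the library is the sup norm. *)
Definition edist (x y : V) : R := Num.sqrt (dotp (x - y) (x - y)).

Definition edist_set (x : V) (K : set V) : R := inf [set edist x y | y in K].

Definition eproj (K : set V) (x : V) : V :=
  get [set y | K y /\ forall z, K z -> edist x y <= edist x z].

Definition aff_indep (k : nat) (p : 'I_k.+1 -> V) : Prop :=
  row_free (\matrix_(i < k) (p (lift ord0 i) - p ord0)).

Definition aff_dim (S : set V) : nat :=
  (\max_(k < n.+1 | `[< exists p : 'I_k.+1 -> V,
                          (forall i, S (p i)) /\ aff_indep p >]) k)%N.

Definition codim (S : set V) : nat := (n - aff_dim S)%N.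

Definition hyperplane (a : V) (b : R) : set V := [set x | dotp a x = b].

Definition strictly_same_side (H : set V) (x y : V) : Prop :=
  exists a b, [/\ a != 0, H = hyperplane a b, b < dotp a x & b < dotp a y].

End Euclidean.

Section Arrangements.
Context {R : realType} {n : nat}.
Local Notation V := 'rV[R]_n.

Definition is_arrangement (A : set (set V)) : Prop :=
  (forall H, A H -> exists a b, a != 0 /\ H = hyperplane a b) /\
  (forall x : V, exists2 U, nbhs x U &
     finite_set [set H | A H /\ H `&` U !=set0]).

Definition same_stratum (A : set (set V)) (x y : V) : Prop :=
  forall H, A H -> (H x /\ H y) \/ strictly_same_side H x y.

Definition is_face (A : set (set V)) (F : set V) : Prop :=
  exists x, F = closure [set y | same_stratum A x y].

Definition is_chamber (A : set (set V)) (C : set V) : Prop :=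
  is_face A C /\ codim C = 0%N.

Definition is_flat (A : set (set V)) (L : set V) : Prop :=
  L !=set0 /\ exists2 B, B `<=` A & L = \bigcap_(H in B) H.

(* Chambers are closed with dense interior, so [H] separates their interiors
   iff they lie in opposite closed half-spaces. *)
Definition sep (A : set (set V)) (C C' : set V) : set (set V) :=
  [set H | A H /\ exists a b, [/\ a != 0, H = hyperplane a b,
     forall x, C x -> dotp a x <= b & forall x, C' x -> b <= dotp a x]].

Definition supp (A : set (set V)) (F : set V) : set (set V) :=
  [set H | A H /\ F `<=` H].

(* [C.F] *)
Definition chamber_at (A : set (set V)) (C F : set V) : set V :=
  get [set C' | [/\ is_chamber A C', F `<=` C' &
                    supp A F `&` sep A C C' = set0]].

(* [C^F], for [F `<=` C] *)
Definition opp_chamber (A : set (set V)) (C F : set V) : set V :=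
  get [set C' | [/\ is_chamber A C', F `<=` C' & sep A C C' = supp A F]].

Definition generic (A : set (set V)) (x : V) : Prop :=
  (forall C C', is_chamber A C -> is_chamber A C' ->
     edist_set x C = edist_set x C' ->
     eproj C x = eproj C' x /\ (C `&` C') (eproj C x)) /\
  (forall L L', is_flat A L -> is_flat A L' -> L' `<=` L -> L' <> L ->
     edist_set x L < edist_set x L').

(* Total orders are given by their strict part, as a relation between
   chambers. *)
Definition chamber_order (A : set (set V)) (ord : set V -> set V -> Prop) :
    Prop :=
  [/\ forall C, is_chamber A C -> ~ ord C C,
      forall C D E, is_chamber A C -> is_chamber A D -> is_chamber A E ->
        ord C D -> ord D E -> ord C E
    & forall C D, is_chamber A C -> is_chamber A D -> C <> D ->
        ord C D \/ ord D C].

Definition euclidean_order (A : set (set V)) (x0 : V)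
    (ord : set V -> set V -> Prop) : Prop :=
  [/\ chamber_order A ord, generic A x0
    & forall C C', is_chamber A C -> is_chamber A C' -> ord C C' ->
        edist_set x0 C <= edist_set x0 C'].

(* [F_C] *)
Definition nearest_face (A : set (set V)) (x0 : V) (C : set V) : set V :=
  get [set F | [/\ is_face A F, F `<=` C, F (eproj C x0) &
     forall G, is_face A G -> G `<=` C -> G (eproj C x0) -> F `<=` G]].

(* The pair [(C, F)] is the cell [<C, F>]. *)
Definition Sal (A : set (set V)) : set (set V * set V) :=
  [set c | [/\ is_chamber A c.1, is_face A c.2 & c.2 `<=` c.1]].

Definition cell_chamber (A : set (set V)) (c : Sal A) : set V := (val c).1.
Definition cell_face (A : set (set V)) (c : Sal A) : set V := (val c).2.
Definition cell_dim (A : set (set V)) (c : Sal A) : nat := codim (cell_face c).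

(* [<C, F> < <D, G>] iff [F] strictly contains [G] and [D.F = C]. *)
Definition cell_lt (A : set (set V)) (c d : Sal A) : Prop :=
  [/\ cell_face d `<=` cell_face c, cell_face c <> cell_face d
    & chamber_at A (cell_chamber d) (cell_face c) = cell_chamber c].

Definition SalS (A : set (set V)) (C : set V) : set (Sal A) :=
  [set c | cell_chamber c = chamber_at A C (cell_face c)].

Definition SalN (A : set (set V)) (ord : set V -> set V -> Prop) (C : set V) :
    set (Sal A) :=
  [set c | SalS C c /\
     forall C', is_chamber A C' -> ord C' C -> ~ SalS C' c].

Definition eta (A : set (set V)) (ord : set V -> set V -> Prop) (c : Sal A) :
    set V * set V :=
  (get [set C | is_chamber A C /\ SalN ord C c],
   opp_chamber A (cell_chamber c) (cell_face c)).

Definition euclidean_matching (A : set (set V)) (x0 : V)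
    (M : set (Sal A * Sal A)) : Prop :=
  [/\ acyclic_matching (@cell_lt A) M,
      generic A x0,
      exists2 ord, euclidean_order A x0 ord & homogeneous (eta ord) M
    & forall c : Sal A,
        critical M c <-> cell_face c = nearest_face A x0 (cell_chamber c)].

End Arrangements.

(* Main.v *)
(* For a flat [L] and a chamber [C], let [w] be the cochain dual to the cells
   [<D, G>] such that [G] spans [L] and [D] is on the same side as [C] of every
   hyperplane containing [L]; with suitable signs it is a cocycle.  If [<C, F>]
   is critical and [L] is the span of [F], any chamber [C'] on the same side as
   [C] of the hyperplanes containing [F] satisfies [C' = C] or comes after [C]
   in the Euclidean order, because the nearest point of [C] to [x0] is also the
   nearest point of the cone at [F] containing [C].  As [eta] decreases along
   the modified Hasse diagram, the cocycle of a critical cell [t] is nonzero on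
   a cell reachable from a critical cell [t'] only if [t' = t], and the cell is
   [t] itself, or if the chamber of [t] precedes that of [t'].  So these cocycles
   form a triangular system with invertible diagonal on the critical cells, and
   evaluating them on Morse boundaries forces all incidence numbers to vanish. *)
Require Import Defs.
From mathcomp Require Import all_boot all_order all_algebra.
From mathcomp Require Import all_classical all_reals all_analysis.
From mathcomp Require Import finmap ring lra zify.

Set Implicit Arguments.
Unset Strict Implicit.
Unset Printing Implicit Defensive.

Import Order.TTheory GRing.Theory Num.Theory.
Import numFieldNormedType.Exports.

Local Open Scope classical_set_scope.
Local Open Scope ring_scope.

(** A Morse boundary sees only critical cells, so a cocycle can be evaluated on it when it vanishes
    on the upper ends of [M]. The flat cocycles need not do so and are first corrected by a
    coboundary. The correction at a critical cell comes from upper ends reachable from it, which is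
    why triangularity concerns all reachable cells and not only critical ones. These recursions
    descend along the modified Hasse diagram; as the arrangement may be infinite, they need finite
    reachable sets. Finiteness holds because, outside finitely many hyperplanes, the home chamber
    and the opposite chamber of every reachable cell stay on the side of [x0].

    The incidence function is arbitrary, so the signs in the cocycles are not given by a formula:
    they arise from iterated coboundaries of truncated cocycles, starting with the constant 1 on
    vertices.

    All geometry is reduced to sign vectors. Faces are represented by points, and new faces are
    reached by small moves from known points. *)

(** * Acyclic graphs with finite reachable sets *)

Section Reachability.
Variables (P : choiceType) (e : rel P).

Definition reachable (x : P) : set P :=
  [set y | exists2 s, path e x s & last x s = y].

Lemma reachable_refl x : reachable x x.
Proof. by exists [::]. Qed.

Lemma reachable_step x y z : e x y -> reachable y z -> reachable x z.
Proof. by move=> exy [s ps <-]; exists (y :: s); rewrite //= exy. Qed.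

Lemma reachable1 x y : e x y -> reachable x y.
Proof. by move=> exy; apply: reachable_step exy (reachable_refl y). Qed.

Hypothesis acyc : forall s, cycle e s -> s = [::].

Lemma acyclic_not_reachable x y : e x y -> ~ reachable y x.
Proof.
move=> exy [s ps lsx]; have := acyc (s := y :: s).
by rewrite /= rcons_path ps lsx exy => /(_ isT).
Qed.

Hypothesis reach_fin : forall x, finite_set (reachable x).

(** It drops strictly along every edge, so it measures the fuel of all recursions along the
    graph. *)
Definition height (x : P) : nat := (#|` fset_set (reachable x)|)%fset.

Lemma height_lt x y : e x y -> (height y < height x)%N.
Proof.
move=> exy; apply/fproper_ltn_card/andP; split.
  apply/fsubsetP => z; rewrite !(in_fset_set (reach_fin _)) !in_setE.
  exact: reachable_step.
apply/negP => /fsubsetP/(_ x); rewrite !(in_fset_set (reach_fin _)) !in_setE.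
by move=> /(_ (reachable_refl _)); exact: acyclic_not_reachable.
Qed.

Lemma acyclic_paths_finite x : finite_set [set s | path e x s].
Proof.
have [n] := ubnP (height x); elim: n x => // n IH x; rewrite ltnS => hx.
apply: (@sub_finite_set _ _ ([set [::]] `|`
   \bigcup_(y in [set y | e x y]) (cons y @` [set s | path e y s]))).
  move=> [|y s] /=; first by left.
  by move=> /andP[exy ps]; right; exists y => //; exists s.
rewrite finite_setU; split; first exact: finite_set1.
apply: bigcup_finite.
  by apply: sub_finite_set (reach_fin x) => y /= /reachable1.
move=> y /= exy; apply: finite_image; apply: IH.
exact: leq_trans (height_lt exy) hx.
Qed.

End Reachability.

(** * Discrete Morse theory: evaluating cocycles on Morse boundaries *)

Section Morse.
Variables (P : choiceType) (lt : P -> P -> Prop) (M : set (P * P)).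
Variable inc : P -> P -> int.
Variable low : P -> seq P.

Hypothesis lt_asym : forall x y, lt x y -> ~ lt y x.
Hypothesis acycM : acyclic_matching lt M.
Hypothesis inc_unit : forall p q, covers lt p q -> inc p q = 1 \/ inc p q = -1.
Hypothesis inc_square : forall p q q' r,
  covers lt p q -> covers lt q r -> covers lt p q' -> covers lt q' r ->
  q <> q' -> inc p q * inc q r + inc p q' * inc q' r = 0.
Hypothesis low_uniq : forall p, uniq (low p).
Hypothesis lowP : forall p q, q \in low p <-> covers lt p q.
Hypothesis thin : forall p q r, covers lt p q -> covers lt q r ->
  exists q', [/\ q' <> q, covers lt p q' & covers lt q' r].

Local Notation E := (matching_graph lt M).

Hypothesis reach_fin : forall x, finite_set (reachable E x).

Definition coboundary (f : P -> int) (p : P) : int :=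
  \sum_(q <- low p) inc p q * f q.

Lemma inc_sqr p q : covers lt p q -> inc p q * inc p q = 1.
Proof. by case/inc_unit => ->; lia. Qed.

(* Among three midpoints of an interval of length two, the pairwise sums of the
   signs [inc p q * inc q r] could not all vanish. *)
Lemma coboundary2 f p : coboundary (coboundary f) p = 0.
Proof.
rewrite /coboundary.
pose L := undup (flatten [seq low q | q <- low p]).
transitivity (\sum_(q <- low p) \sum_(r <- L)
    (if r \in low q then inc p q * inc q r else 0) * f r).
  rewrite big_seq [RHS]big_seq; apply: eq_bigr => q qp.
  rewrite mulr_sumr.
  rewrite [RHS](eq_bigr (fun r => if r \in low q then inc p q * inc q r * f r else 0));
    last by move=> r _; case: ifP; rewrite ?mul0r.
  rewrite -big_mkcond /= -[RHS]big_filter.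
  rewrite [RHS](perm_big (low q)) /=; last first.
    apply: uniq_perm; rewrite ?filter_uniq ?undup_uniq // => r.
    rewrite mem_filter mem_undup; case: (boolP (r \in low q)) => //= rq.
    by apply/flattenP; exists (low q) => //; apply: map_f.
  by apply: eq_bigr => r _; rewrite mulrA.
rewrite exchange_big /= big1 // => r _; rewrite -mulr_suml.
suff -> : \sum_(q <- low p) (if r \in low q then inc p q * inc q r else 0) = 0.
  by rewrite mul0r.
have [[q [qp qr]]|nq] := pselect (exists q, q \in low p /\ r \in low q); last first.
  rewrite big_seq big1 // => q qp; case: ifP => // rq.
  by case: nq; exists q.
have [q' [nqq' pq' q'r]] := thin ((lowP _ _).1 qp) ((lowP _ _).1 qr).
have q'p : q' \in low p by apply/lowP.
rewrite (perm_big _ (perm_to_rem qp)) /= big_cons qr.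
have q'rem : q' \in rem q (low p).
  by rewrite mem_rem_uniq // inE q'p andbT; apply/eqP.
rewrite (perm_big _ (perm_to_rem q'rem)) /= big_cons.
have -> : r \in low q' by apply/lowP.
rewrite addrA inc_square //; first last.
- by move=> /esym.
- exact/lowP.
- exact/lowP.
rewrite add0r big_seq big1 // => x.
rewrite mem_rem_uniq ?rem_uniq // inE mem_rem_uniq // inE => /and3P[xq' xq xp].
case: ifP => // xr; exfalso.
move/lowP: xp => xp; move/lowP: xr => xr; move/lowP: qp => qp; move/lowP: qr => qr.
have h1 := inc_square qp qr pq' q'r (nesym nqq').
have h2 : inc p q * inc q r + inc p x * inc x r = 0.
  by apply: inc_square => // qx; rewrite qx eqxx in xq.
have h3 : inc p q' * inc q' r + inc p x * inc x r = 0.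
  by apply: inc_square => // qx; rewrite qx eqxx in xq'.
have : inc p q * inc q r = 0 by lia.
by case: (inc_unit qp) => ->; case: (inc_unit qr) => ->.
Qed.

Definition is_lower (r : P) : bool := `[< exists p, M (p, r) >].
Definition partner (r : P) : P := xget r [set p | M (p, r)].

Lemma is_lowerP r : is_lower r -> M (partner r, r).
Proof. by move/asboolP; apply: xgetPex. Qed.

Lemma matching_lower_uniq p q r : M (p, r) -> M (q, r) -> p = q.
Proof.
case: acycM => -[_ MU] _ pr qr.
by have [] := MU _ _ r pr qr (or_intror erefl) (or_intror erefl).
Qed.

Lemma matching_upper_uniq p q r : M (p, q) -> M (p, r) -> q = r.
Proof.
case: acycM => -[_ MU] _ pq pr.
by have [] := MU _ _ p pq pr (or_introl erefl) (or_introl erefl).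
Qed.

Lemma partnerE p r : M (p, r) -> partner r = p.
Proof.
move=> pr; apply/esym/(matching_lower_uniq pr).
by apply: is_lowerP; apply/asboolP; exists p.
Qed.

Lemma matching_covers p r : M (p, r) -> covers lt p r.
Proof. by case: acycM => -[MH _] _ /MH. Qed.

Lemma edge_up p r : M (p, r) -> E r p.
Proof. by move=> pr; apply/asboolP; right; split=> //; exact: matching_covers. Qed.

Lemma edge_down p r : covers lt p r -> ~ M (p, r) -> E p r.
Proof. by move=> pr nM; apply/asboolP; left. Qed.

Local Notation ht := (height E).

Lemma ht_lt x y : E x y -> (ht y < ht x)%N.
Proof. by case: acycM => _ ac; apply: height_lt. Qed.

Lemma ht_zigzag p q d : covers lt p q -> ~ M (p, q) -> M (d, q) ->
  (ht d < ht p)%N.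
Proof.
by move=> pq nM /edge_up/ht_lt dq; exact: ltn_trans dq (ht_lt (edge_down pq nM)).
Qed.

(* The alternating paths from [p] to a critical cell whose first edge is
   unmatched; the fuel [n] must exceed the height of [p]. *)
Fixpoint critical_paths (n : nat) (p : P) : seq (seq P) :=
  if n is n'.+1 then
    flatten [seq (if `[< M (p, q) >] then [::]
      else if `[< critical M q >] then [:: [:: q]]
      else if is_lower q then
        [seq [:: q, partner q & s] | s <- critical_paths n' (partner q)]
      else [::]) | q <- low p]
  else [::].

(** At a matched lower end [q] with partner [d], the cocycle equation at [d] expresses [w q] through
    the other cells covered by [d], with factor [- inc d q]. This is the factor that [path_weight]
    attaches to a zigzag, so values are pushed along zigzags until critical ends are reached; upper
    ends contribute nothing by the second hypothesis. *)
Lemma critical_paths_sum (w : P -> int) n p :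
  (forall q, coboundary w q = 0) -> (forall p q, M (p, q) -> w p = 0) ->
  (ht p < n)%N ->
  \sum_(s <- critical_paths n p) path_weight inc p s * w (last p s) =
  \sum_(q <- low p | ~~ `[< M (p, q) >]) inc p q * w q.
Proof.
move=> wcoc wtop; elim: n p => // n IH p; rewrite ltnS => hp /=.
rewrite big_flatten /= big_map [RHS]big_mkcond /= big_seq [RHS]big_seq.
apply: eq_bigr => q /lowP pq.
case: asboolP => Mpq /=; first by rewrite big_nil.
case: asboolP => cq /=; first by rewrite big_seq1.
case: ifP => [/is_lowerP lq|nlq]; last first.
  rewrite big_nil; suff -> : w q = 0 by rewrite mulr0.
  have [[r Mqr]|nq] := pselect (exists r, M (q, r)); first exact: wtop Mqr.
  exfalso; apply: cq => -[a b] ab; split=> /= qE.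
    by apply: nq; exists b; rewrite qE.
  by move/asboolP: nlq; apply; exists a; rewrite qE.
rewrite big_map /=; set d := partner q in lq *.
have dq := matching_covers lq.
under eq_bigr do rewrite -mulrA.
rewrite -mulr_sumr IH; last exact: leq_trans (ht_zigzag pq Mpq lq) hp.
have -> : \sum_(i <- low d | ~~ `[< M (d, i) >]) inc d i * w i =
          - (inc d q * w q).
  have := wcoc d; rewrite /coboundary.
  have qd : q \in low d by apply/lowP.
  rewrite (bigD1_seq q) //= => /eqP; rewrite addrC addr_eq0 => /eqP <-.
  rewrite big_seq_cond [RHS]big_seq_cond; apply: eq_bigl => i.
  case: (boolP (i \in low d)) => //= _; congr (~~ _).
  apply/asboolP/eqP => [/matching_upper_uniq/(_ lq)//|->//].
transitivity (inc p q * (inc d q * inc d q) * w q); first by ring.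
by rewrite inc_sqr // mulr1.
Qed.
Lemma critical_paths_head n p s : s \in critical_paths n p ->
  [/\ s != [::], covers lt p (head p s) & ~ M (p, head p s)].
Proof.
case: n => //= n /flattenP[l /mapP[q /lowP pq ->]].
case: asboolP => // Mpq; case: ifP => _; first by rewrite inE => /eqP ->.
by case: ifP => // _ /mapP[t _ ->].
Qed.

Lemma critical_paths_uniq n p : uniq (critical_paths n p).
Proof.
elim: n p => //= n IH p.
elim: (low p) (low_uniq p) => //= q l IHl /andP[ql ul].
rewrite cat_uniq IHl // andbT; apply/andP; split.
  case: ifP => // _; case: ifP => // _; case: ifP => // _.
  by rewrite map_inj_uniq // => x y [].
apply/hasPn => s /flattenP[l' /mapP[q' q'l ->]] sl'; apply/negP => sl.
have h (r : P) : s \in (if `[< M (p, r) >] then [::]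
      else if `[< critical M r >] then [:: [:: r]]
      else if is_lower r then
        [seq [:: r, partner r & s] | s <- critical_paths n (partner r)]
      else [::]) -> head p s = r.
  case: ifP => // _; case: ifP => _; first by rewrite inE => /eqP ->.
  by case: ifP => // _ /mapP[t _ ->].
by move: ql; rewrite -(h _ sl) (h _ sl') q'l.
Qed.

Lemma matched_up p q : M (p, q) -> matched M q p.
Proof. by move=> pq; apply/asboolP; right. Qed.

Lemma unmatched_down p q : covers lt p q -> ~ M (p, q) -> matched M p q = false.
Proof.
move=> pq nM; apply/asboolP => -[//|/matching_covers[qp _]].
by case: pq => /lt_asym.
Qed.

Lemma critical_paths_sound n p s : s \in critical_paths n p ->
  [/\ path E p s, Defs.alternating M p s & critical M (last p s)].
Proof.
elim: n p s => //= n IH p s /flattenP[l /mapP[q /lowP pq ->]].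
case: asboolP => // Mpq; case: asboolP => cq.
  rewrite inE => /eqP -> /=; split=> //; rewrite andbT.
  exact: edge_down.
case: ifP => // /is_lowerP lq /mapP[t]; set d := partner q in lq * => tn -> /=.
have [pt at_ ct] := IH _ _ tn.
have [tn0 ch nM] := critical_paths_head tn.
split=> //; first by rewrite edge_down // edge_up.
rewrite (matched_up lq) (unmatched_down pq Mpq) at_ andbT /=.
by case: t tn0 ch nM {tn pt at_ ct} => //= z t _ ch nM; rewrite (unmatched_down ch nM).
Qed.

Lemma critical_paths_complete n p s : (ht p < n)%N -> s != [::] ->
  covers lt p (head p s) -> ~ M (p, head p s) ->
  path E p s -> Defs.alternating M p s -> critical M (last p s) ->
  s \in critical_paths n p.
Proof.
elim: n p s => // n IH p [//|q s]; rewrite ltnS => hp _ /= pq Mpq.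
move=> /andP[Epq ps] /andP[a1 a2] cl.
apply/flattenP; eexists; first by apply/mapP; exists q; [exact/lowP|reflexivity].
case: asboolP => // _.
case: s ps a1 a2 cl => [|d s] /=; first by move=> _ _ _ cq; rewrite asboolT ?inE.
move=> /andP[Eqd ps]; rewrite (unmatched_down pq Mpq) /=; case mqd: (matched M q d) => // _.
move=> /andP[a1 a2] cl.
have dq : M (d, q).
  by move/asboolP: mqd => [qd|//]; move/asboolP: Eqd => -[[_ /(_ qd)]|[_]].
have lq : is_lower q by apply/asboolP; exists d.
rewrite asboolF; last by move/(_ _ dq) => [].
rewrite lq (partnerE dq); apply: map_f.
have s0 : s != [::].
  by apply/eqP => s0; move: cl; rewrite s0 /= => /(_ _ dq) [].
have [hd nM] : covers lt d (head d s) /\ ~ M (d, head d s).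
  case: s s0 ps a1 {a2 cl} => // z s _ /= /andP[/asboolP Edz _].
  case dz: (matched M d z) => // _; move/asboolPn/not_orP: (negbT dz) => [nM nM'].
  by case: Edz => [[]|[_ /nM']].
by apply: IH => //; exact: leq_trans (ht_zigzag pq Mpq dq) hp.
Qed.

(** The empty path is alternating when [sigma = tau]; its weight is 0, so removing it does not
    affect the incidence number. *)
Lemma alternating_paths_critical sigma tau n : (ht sigma < n)%N ->
  critical M sigma -> critical M tau ->
  alternating_paths lt M sigma tau `\ [::] =
  [set` [seq s <- critical_paths n sigma | last sigma s == tau]].
Proof.
move=> hn cs ct; apply/seteqP; split=> s /=.
  move=> [[ps ls als] /eqP s0]; rewrite mem_filter ls eqxx /=.
  have [hd nM] : covers lt sigma (head sigma s) /\ ~ M (sigma, head sigma s).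
    case: s s0 ps {ls als} => // z s _ /= /andP[/asboolP[//|[_ /cs[]//]]].
  by apply: critical_paths_complete => //; rewrite ls.
rewrite mem_filter => /andP[/eqP ls sn]; have [ps als cl] := critical_paths_sound sn.
by have [/eqP s0 _ _] := critical_paths_head sn.
Qed.

Lemma morse_incidenceE sigma tau n : (ht sigma < n)%N ->
  critical M sigma -> critical M tau ->
  morse_incidence lt inc M sigma tau =
  \sum_(s <- critical_paths n sigma | last sigma s == tau)
    path_weight inc sigma s.
Proof.
move=> hn cs ct; rewrite -big_filter fsbig_seq ?filter_uniq ?critical_paths_uniq //.
rewrite -(alternating_paths_critical hn cs ct) /morse_incidence.
apply/esym/fsbig_widen; first by move=> s [].
by move=> s [ps /not_andP[//|/contrapT ->]].
Qed.

(** The solution [b], supported on lower ends, of [coboundary b q = w q] at all upper ends [q]. The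
    system is triangular: from [r] to its partner [q] and down to another [r'] are two edges of the
    modified Hasse diagram. The fuel [n] must exceed the height of [r]. *)
Fixpoint lower_cochain (w : P -> int) (n : nat) (r : P) : int :=
  if n is n'.+1 then
    if is_lower r then
      let q := partner r in
      inc q r * (w q - \sum_(r' <- low q | r' != r) inc q r' * lower_cochain w n' r')
    else 0
  else 0.

Lemma lower_cochain_stable w n m r : (ht r < n)%N -> (ht r < m)%N ->
  lower_cochain w n r = lower_cochain w m r.
Proof.
elim: n m r => // n IH [//|m] r; rewrite !ltnS => hn hm /=.
case: ifP => // /is_lowerP; set q := partner r => qr; congr (_ * (_ - _)).
rewrite big_seq_cond [RHS]big_seq_cond; apply: eq_bigr => r' /andP[/lowP qr' r'r].
have nM : ~ M (q, r') by move=> /matching_upper_uniq/(_ qr)/eqP; apply/negP.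
have h : (ht r' < ht r)%N.
  exact: ltn_trans (ht_lt (edge_down qr' nM)) (ht_lt (edge_up qr)).
by rewrite (IH m) // (leq_trans h).
Qed.

Lemma lower_cochain_support w n r : lower_cochain w n r != 0 ->
  exists p c, [/\ reachable E r p, M (p, c) & w p != 0].
Proof.
elim: n r => [//|n IH] r /=.
case: ifP => [/is_lowerP|//].
set q := partner r => qr; rewrite mulf_eq0 negb_or => /andP[_].
have [wq|wq _] := eqVneq (w q) 0; last first.
  by exists q, r; split=> //; apply: reachable1; exact: edge_up.
rewrite wq sub0r oppr_eq0 => /eqP hs.
have [r' [/lowP qr' r'r]] : exists r', [/\ r' \in low q, r' != r &
    inc q r' * lower_cochain w n r' != 0].
  apply: contrapT => hn; apply: hs; rewrite big_seq_cond big1 // => r'.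
  move=> /andP[r'q r'r]; apply/eqP/negPn/negP => ne; apply: hn.
  by exists r'.
rewrite mulf_eq0 negb_or => /andP[_ /IH[p [c [r'p pc wp]]]].
exists p, c; split=> //; apply: reachable_step (edge_up qr) _.
apply: reachable_step r'p; apply: edge_down => //.
by move=> /matching_upper_uniq/(_ qr)/eqP; apply/negP.
Qed.

(* Subtracting the coboundary of a cochain supported on the lower ends of the
   matching kills the values of a cocycle on the upper ends. *)
Lemma cocycle_reduction (w : P -> int) : (forall p, coboundary w p = 0) ->
  exists w' : P -> int, [/\ forall p, coboundary w' p = 0,
    forall p q, M (p, q) -> w' p = 0
  & forall t, critical M t -> w' t = w t \/
      exists p c, [/\ reachable E t p, M (p, c) & w p != 0]].
Proof.
move=> cw; pose b r := lower_cochain w (ht r).+1 r.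
exists (fun p => w p - coboundary b p); split.
- move=> p; have := cw p; have := coboundary2 b p; rewrite /coboundary => h1 h2.
  under eq_bigr do rewrite mulrBr.
  by rewrite sumrB h1 h2 subrr.
- move=> q r qr; apply/eqP; rewrite subr_eq0 eq_sym; apply/eqP.
  have lr : is_lower r by apply/asboolP; exists q.
  have cqr := matching_covers qr.
  rewrite /coboundary (bigD1_seq r) //=; last exact/lowP.
  rewrite {1}/b /= lr (partnerE qr) mulrA inc_sqr // mul1r.
  rewrite -[RHS](subrK (\sum_(r' <- low q | r' != r) inc q r' * b r')).
  congr (_ - _ + _).
  rewrite big_seq_cond [RHS]big_seq_cond; apply: eq_bigr => r' /andP[/lowP qr' r'r].
  congr (_ * _); apply: lower_cochain_stable => //.
  have nM : ~ M (q, r') by move=> /matching_upper_uniq/(_ qr)/eqP; apply/negP.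
  exact: ltn_trans (ht_lt (edge_down qr' nM)) (ht_lt (edge_up qr)).
- move=> t ct.
  have [[r [tr br]]|nr] := pselect (exists r, r \in low t /\ b r != 0).
    right; have [p [c [rp pc wp]]] := lower_cochain_support br.
    exists p, c; split=> //; apply: reachable_step rp; apply: edge_down.
      exact/lowP.
    by move=> /ct[].
  left; rewrite /coboundary big_seq big1 ?subr0 // => r rt.
  have [->|br] := eqVneq (b r) 0; first by rewrite mulr0.
  by case: nr; exists r.
Qed.

(** Let [w] be the reduced cocycle of [tau]. Its sum over the critical paths from [sigma] is 0, and
    also the sum of [N t * w t] over their ends [t]. For [t != tau], a nonzero [w t] forces
    [prec tau t], where [N t = 0] by induction; what remains is [N tau * w tau = 0]. *)
Theorem morse_incidence_vanish (prec : P -> P -> Prop) (W : P -> P -> int) :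
  (forall x, ~ prec x x) ->
  (forall x y z, critical M x -> critical M y -> critical M z ->
     prec x y -> prec y z -> prec x z) ->
  (forall t, critical M t -> forall p, coboundary (W t) p = 0) ->
  (forall t, critical M t -> W t t != 0) ->
  (forall t t' c, critical M t -> critical M t' -> reachable E t' c ->
     W t c != 0 -> (c = t' /\ t' = t) \/ prec t t') ->
  forall sigma tau, critical M sigma -> critical M tau ->
  morse_incidence lt inc M sigma tau = 0.
Proof.
move=> irr trans cW Wt tri sigma tau cs ct.
pose n := (ht sigma).+1; pose L := critical_paths n sigma.
pose N t := \sum_(s <- L | last sigma s == t) path_weight inc sigma s.
rewrite (morse_incidenceE (ltnSn _) cs ct) -/(N tau).
pose T := undup [seq last sigma s | s <- L].
have NT t : t \notin T -> N t = 0.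
  rewrite mem_undup => tT; rewrite /N big_seq_cond big1 // => s /andP[sL /eqP st].
  by case/negP: tT; rewrite -st; apply: map_f.
(* No well-foundedness of [prec] is assumed: the induction counts the ends above [tau] among the
   finitely many ends of paths from [sigma]. *)
have [m] := ubnP (size [seq t <- T | `[< prec tau t >]]).
elim: m tau ct => // m IH tau ct; rewrite ltnS => hm.
have IHt t : critical M t -> prec tau t -> N t = 0.
  move=> ct' taut; have [/NT//|/negbNE tT] := boolP (t \notin T).
  apply: IH => //; apply: leq_trans hm.
  apply: (@uniq_leq_size _ (t :: [seq x <- T | `[< prec t x >]])) => [|x].
    rewrite /= filter_uniq ?undup_uniq // andbT mem_filter.
    by apply/negP => /andP[/asboolP/irr].
  rewrite inE => /predU1P[->|]; rewrite !mem_filter; first by rewrite tT asboolT.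
  move=> /andP[/asboolP tx xT]; rewrite xT andbT; apply/asboolP.
  apply: trans tx => //; move: xT; rewrite mem_undup => /mapP[s sL ->].
  by have [] := critical_paths_sound sL.
have [w [cw wtop wcrit]] := cocycle_reduction (cW tau ct).
(* A correction at [tau] would come from an upper end reachable from [tau]; by triangularity this
   cell would be the critical cell [tau], or [prec tau tau] would hold. *)
have wt : w tau != 0.
  case: (wcrit tau ct) => [->|[p [c [tp pc Wp]]]]; first exact: Wt.
  exfalso; case: (tri tau tau p ct ct tp Wp) => [[pt _]|]; last exact: irr.
  by case: (ct _ pc) => /=; rewrite pt.
have w0 t : critical M t -> t != tau -> w t != 0 -> prec tau t.
  move=> ct' /eqP tt wt'; case: (wcrit t ct') => [wE|[p [c [tp pc Wp]]]].
    rewrite wE in wt'.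
    by case: (tri tau t t ct ct' (reachable_refl _ _) wt') => // -[_ /tt].
  case: (tri tau t p ct ct' tp Wp) => // -[pt _].
  by case: (ct' _ pc) => /=; rewrite pt.
have := critical_paths_sum cw wtop (ltnSn (ht sigma)).
(* As [sigma] is critical, the filter removes nothing and the sum is a full coboundary. *)
have -> : \sum_(q <- low sigma | ~~ `[< M (sigma, q) >]) inc sigma q * w q = 0.
  rewrite -[RHS](cw sigma) /coboundary; apply: eq_bigl => q.
  by rewrite asboolF // => /cs[].
have -> : \sum_(s <- critical_paths (ht sigma).+1 sigma)
    path_weight inc sigma s * w (last sigma s) = N tau * w tau.
  have key t : critical M t -> t != tau -> N t * w t = 0.
    move=> ct' tt; have [->|wt'] := eqVneq (w t) 0; first by rewrite mulr0.
    by rewrite (IHt t) ?mul0r //; exact: w0.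
  transitivity (\sum_(t <- T) N t * w t).
    transitivity (\sum_(s <- L) \sum_(t <- T)
        (if last sigma s == t then path_weight inc sigma s * w t else 0)).
      rewrite big_seq [RHS]big_seq; apply: eq_bigr => s sL.
      rewrite (bigD1_seq (last sigma s)) ?undup_uniq ?mem_undup ?map_f //= eqxx.
      by rewrite big1 ?addr0 // => t; rewrite eq_sym => /negPf ->.
    rewrite exchange_big /=; apply: eq_bigr => t _.
    by rewrite /N big_distrl /= [RHS]big_mkcond.
  have [tT|tT] := boolP (tau \in T); last first.
    rewrite NT // mul0r big_seq big1 // => t tT'; apply: key.
      by move: tT'; rewrite mem_undup => /mapP[s /critical_paths_sound[_ _ ?] ->].
    by apply: contraNneq tT => <-.
  rewrite (bigD1_seq tau) ?undup_uniq //= big_seq_cond big1 ?addr0 // => t.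
  case/andP; rewrite mem_undup => /mapP[s /critical_paths_sound[_ _ ?] ->].
  exact: key.
by move/eqP; rewrite mulf_eq0 (negPf wt) orbF => /eqP.
Qed.

End Morse.

(** * The Euclidean inner product and its continuity *)

Section DotProduct.
Variables (R : realType) (n : nat).
Local Notation V := 'rV[R]_n.
Implicit Types (x y z v : V).

Lemma dotpC x y : dotp x y = dotp y x.
Proof. by apply: eq_bigr => i _; rewrite mulrC. Qed.

Lemma dotpDr x y z : dotp x (y + z) = dotp x y + dotp x z.
Proof. by rewrite -big_split /=; apply: eq_bigr => i _; rewrite mxE mulrDr. Qed.

Lemma dotpZr x t y : dotp x (t *: y) = t * dotp x y.
Proof. by rewrite mulr_sumr; apply: eq_bigr => i _; rewrite mxE mulrCA. Qed.

Lemma dotpNr x y : dotp x (- y) = - dotp x y.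
Proof. by rewrite -scaleN1r dotpZr mulN1r. Qed.

Lemma dotpBr x y z : dotp x (y - z) = dotp x y - dotp x z.
Proof. by rewrite dotpDr dotpNr. Qed.

Lemma dotpDl x y z : dotp (x + y) z = dotp x z + dotp y z.
Proof. by rewrite dotpC dotpDr !(dotpC z). Qed.

Lemma dotpZl x t y : dotp (t *: x) y = t * dotp x y.
Proof. by rewrite dotpC dotpZr (dotpC y). Qed.

Lemma dotpNl x y : dotp (- x) y = - dotp x y.
Proof. by rewrite dotpC dotpNr (dotpC y). Qed.

Lemma dotpBl x y z : dotp (x - y) z = dotp x z - dotp y z.
Proof. by rewrite dotpDl dotpNl. Qed.

Lemma dotp_ge0 x : 0 <= dotp x x.
Proof. by apply: sumr_ge0 => i _; rewrite -expr2 sqr_ge0. Qed.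

Lemma dotp_coord_le x i : x 0 i ^+ 2 <= dotp x x.
Proof.
rewrite /dotp (bigD1 i) //= -expr2 lerDl.
by apply: sumr_ge0 => j _; rewrite -expr2 sqr_ge0.
Qed.

Lemma dotp_continuous (a : V) : continuous (dotp a).
Proof.
apply: (@continuous_big R _ +%R 0 xpredT _ _ _ (fun i x => a 0 i * x 0 i)).
  exact: (@add_continuous R).
move=> i _ x.
have h1 := @cvg_cst R (a 0 i) V (nbhs x) (nbhs_filter x).
have h2 : (fun y : V => y 0 i) @ x --> x 0 i by exact: coord_continuous.
exact: (@cvgM _ _ _ (nbhs_filter x) _ _ _ _ h1 h2).
Qed.

Lemma sqdist_continuous (a : V) : continuous (fun x => dotp (a - x) (a - x)).
Proof.
apply: (@continuous_big R _ +%R 0 xpredT _ _ _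
  (fun i x => (a - x) 0 i * (a - x) 0 i)).
  exact: (@add_continuous R).
move=> i _ x; have h : (a - y) 0 i @[y --> x] --> (a - x) 0 i.
  rewrite (_ : (fun y => _) = fun y : V => a 0 i - y 0 i); last first.
    by apply/funext => y; rewrite !mxE.
  have h1 := @cvg_cst R (a 0 i) V (nbhs x) (nbhs_filter x).
  have h2 : (fun y : V => y 0 i) @ x --> x 0 i by exact: coord_continuous.
  by rewrite !mxE; exact: (@cvgB _ _ _ _ (nbhs_filter x) _ _ _ _ h1 h2).
exact: (@cvgM _ _ _ (nbhs_filter x) _ _ _ _ h h).
Qed.

Lemma nbhs_ray (x v : V) (U : set V) : nbhs x U ->
  exists2 d : R, 0 < d & forall t, 0 <= t -> t <= d -> U (x + t *: v).
Proof.
move=> /nbhs_ballP[e /= e0 xU].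
exists (e / (`|v| + 1)); first by rewrite divr_gt0 // ltr_wpDl.
move=> t t0 td; apply: xU; rewrite -ball_normE /= opprD addNKr normrN normrZ ger0_norm //.
apply: le_lt_trans (_ : e / (`|v| + 1) * `|v| < e).
  by rewrite ler_wpM2r.
by rewrite mulrAC ltr_pdivrMr ?ltr_wpDl // ltr_pM2l // ltrDl.
Qed.

End DotProduct.

(** * Sign vectors of points; strata and faces in terms of signs *)

Section Signs.
Variables (R : realType) (n : nat) (A : set (set 'rV[R]_n)).
Hypothesis hA : is_arrangement A.
Local Notation V := 'rV[R]_n.
Implicit Types (H : set V) (x y z v w : V).

(** Sides and separation are defined by quantifying over equations; fixing one equation per
    hyperplane gives signs, whose agreement does not depend on the choice. *)
Definition normal H : V := xget 0 [set a | a != 0 /\ exists b, H = hyperplane a b].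
Definition offset H : R := xget 0 [set b | H = hyperplane (normal H) b].
Definition lin H v : R := dotp (normal H) v.
Definition ev H x : R := lin H x - offset H.
Definition sg H x : R := Num.sg (ev H x).

Lemma normalP H : A H -> normal H != 0 /\ H = hyperplane (normal H) (offset H).
Proof.
move=> AH; have [a [b [a0 HE]]] := hA.1 H AH.
have [n0 [c Hc]] : normal H != 0 /\ exists b, H = hyperplane (normal H) b.
  by apply: (@xgetPex _ 0 [set a | a != 0 /\ exists b, H = hyperplane a b]); exists a; split=> //; exists b.
by split=> //; apply: (@xgetPex _ 0 [set b | H = hyperplane (normal H) b]); exists c.
Qed.

Lemma ev_eq0 H x : A H -> H x <-> ev H x = 0.
Proof.
move=> /normalP[_ HE]; rewrite {1}HE /hyperplane /ev /lin /=.
by split=> [->|/subr0_eq//]; rewrite subrr.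
Qed.

Lemma sg_eq0 H x : A H -> H x <-> sg H x = 0.
Proof.
move=> AH; rewrite (ev_eq0 _ AH); split=> [e|/eqP]; first by rewrite /sg e sgr0.
by rewrite sgr_eq0 => /eqP.
Qed.

Lemma linD H v w : lin H (v + w) = lin H v + lin H w.
Proof. exact: dotpDr. Qed.
Lemma linZ H t v : lin H (t *: v) = t * lin H v.
Proof. exact: dotpZr. Qed.
Lemma linN H v : lin H (- v) = - lin H v.
Proof. exact: dotpNr. Qed.
Lemma linB H v w : lin H (v - w) = lin H v - lin H w.
Proof. exact: dotpBr. Qed.
Lemma evD H x v : ev H (x + v) = ev H x + lin H v.
Proof. by rewrite /ev linD addrAC. Qed.
Lemma lin_ev H x y : lin H (y - x) = ev H y - ev H x.
Proof. by rewrite linB /ev; ring. Qed.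

Lemma sgE (r : R) : [\/ (r < 0) /\ Num.sg r = -1, r = 0 /\ Num.sg r = 0 |
  0 < r /\ Num.sg r = 1].
Proof.
case: (ltgtP r 0) => [h|h|->]; last by constructor 2; rewrite sgr0.
  by constructor 1; rewrite ltr0_sg.
by constructor 3; rewrite gtr0_sg.
Qed.

Lemma sg_segment H x y : A H -> sg H x <> sg H y ->
  exists2 t, 0 <= t <= 1 & H (x + t *: (y - x)).
Proof.
move=> AH nxy.
exists (ev H x / (ev H x - ev H y)); last first.
  apply/(ev_eq0 _ AH); rewrite evD linZ lin_ev.
  suff : ev H x - ev H y != 0 by move=> ?; field.
  by rewrite subr_eq0; apply/eqP => e; apply: nxy; rewrite /sg e.
move: nxy; rewrite /sg; set a := ev H x; set b := ev H y => nab.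
have [ab|ab] : a < b /\ a <= 0 <= b \/ b < a /\ b <= 0 <= a.
- case: (sgE a) nab => -[ha ->]; case: (sgE b) => -[hb ->] // _;
    by [left; lra | right; lra].
- rewrite -mulrNN -invrN divr_ge0 ?ler_pdivrMr //=; lra.
- rewrite divr_ge0 ?ler_pdivrMr //=; lra.
Qed.

Lemma segment_same_side H x y t : strictly_same_side H x y -> 0 <= t <= 1 ->
  ~ H (x + t *: (y - x)).
Proof.
move=> [a [b [_ -> hx hy]]] /andP[t0 t1]; rewrite /hyperplane /= dotpDr dotpZr dotpBr => e.
have [xy|/ltW yx] := leP (dotp a x) (dotp a y).
  have : 0 <= t * (dotp a y - dotp a x) by rewrite mulr_ge0 ?subr_ge0.
  lra.
have : 0 <= (1 - t) * (dotp a x - dotp a y) by rewrite mulr_ge0 ?subr_ge0.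
lra.
Qed.

Lemma hyperplaneN (a : V) b : hyperplane (- a) (- b) = hyperplane a b.
Proof.
by apply/seteqP; split=> z; rewrite /hyperplane /= dotpNl; [exact: oppr_inj | move=> ->].
Qed.

Lemma same_sign_same_side H x y : A H -> sg H x != 0 -> sg H x = sg H y ->
  strictly_same_side H x y.
Proof.
move=> AH; have [a0 HE] := normalP AH; rewrite /sg /ev /lin.
case: (sgE (dotp (normal H) x - offset H)) => -[hx ->];
  case: (sgE (dotp (normal H) y - offset H)) => -[hy ->] => /eqP n0 e;
  try by []; try (exfalso; clear HE; lra).
- exists (- normal H), (- offset H); rewrite hyperplaneN oppr_eq0 !dotpNl.
  by split=> //; clear HE; lra.
- by exists (normal H), (offset H); split=> //; clear HE; lra.
Qed.

Lemma same_stratumP x y :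
  same_stratum A x y <-> forall H, A H -> sg H x = sg H y.
Proof.
split=> [h H AH|h H AH].
  case: (h H AH) => [[/(sg_eq0 _ AH) -> /(sg_eq0 _ AH) ->]//|ss].
  apply: contrapT => /(sg_segment AH)[t t01]; exact: segment_same_side.
have [h0|h0] := eqVneq (sg H x) 0; last by right; apply: same_sign_same_side => //; exact: h.
by left; split; apply/(sg_eq0 _ AH); rewrite // -h.
Qed.

Lemma sg_near H x : A H -> sg H x != 0 -> \forall z \near x, sg H z = sg H x.
Proof.
move=> AH; have cev : ev H z @[z --> x] --> ev H x.
  have h1 := @cvg_cst R (offset H) V (nbhs x) (nbhs_filter x).
  exact: (@cvgB _ _ _ _ (nbhs_filter x) _ _ _ _ (dotp_continuous (a := normal H) (x:=x)) h1).
rewrite /sg; case: (sgE (ev H x)) => -[hx ->]; rewrite ?eqxx // => _.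
- apply: filterS (@cvgr_lt _ _ _ (nbhs_filter x) _ _ cev 0 hx) => z.
  exact: ltr0_sg.
- apply: filterS (@cvgr_gt _ _ _ (nbhs_filter x) _ _ cev 0 hx) => z.
  exact: gtr0_sg.
Qed.

Definition sle x y := forall H, A H -> sg H x = 0 \/ sg H x = sg H y.
Definition sgeq x y := forall H, A H -> sg H x = sg H y.
Definition face x : set V := [set y | sle y x].

Lemma sgeq_sym x y : sgeq x y -> sgeq y x. Proof. by move=> h H /h. Qed.
Lemma sgeq_trans y x z : sgeq x y -> sgeq y z -> sgeq x z.
Proof. by move=> xy yz H AH; rewrite xy // yz. Qed.
Lemma sle_refl x : sle x x. Proof. by right. Qed.
Lemma sle_trans y x z : sle x y -> sle y z -> sle x z.
Proof.
move=> xy yz H AH; case: (xy H AH) => [|->]; first by left.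
exact: yz.
Qed.
Lemma sgeq_sle x y : sgeq x y -> sle x y. Proof. by move=> h H /h; right. Qed.
Lemma sle_anti x y : sle x y -> sle y x -> sgeq x y.
Proof.
move=> xy yx H AH; case: (xy H AH) => // x0; case: (yx H AH) => // y0.
by rewrite x0 y0.
Qed.

Lemma sg_segment_face x y t : sle y x -> 0 < t <= 1 -> sgeq (y + t *: (x - y)) x.
Proof.
move=> yx /andP[t0 t1] H AH; have := yx H AH.
rewrite /sg evD linZ lin_ev.
case: (sgE (ev H x)) => -[hx ->]; case: (sgE (ev H y)) => -[hy ->];
  case=> e; try (exfalso; lra); rewrite ?hx ?hy ?subrr ?mulr0 ?addr0 ?sgr0 ?subr0 ?add0r //.
all: first [by rewrite ltr0_sg //; nra | by rewrite gtr0_sg //; nra].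
Qed.

(** Nonzero signs are locally constant, which gives one inclusion. For the other, the segment from a
    point of [face x] to [x] lies in the stratum of [x] except perhaps at its start. *)
Lemma closure_stratum x : closure [set y | same_stratum A x y] = face x.
Proof.
apply/seteqP; split=> y.
  move=> cy H AH; case: (eqVneq (sg H y) 0) => [->|y0]; [by left|right].
  have [z [/same_stratumP xz zy]] := cy _ (sg_near AH y0).
  by rewrite -zy xz.
move=> yx U /(nbhs_ray (x - y))[d d0 hU].
exists (y + Num.min d 1 *: (x - y)); split.
  apply/same_stratumP/sgeq_sym/sg_segment_face => //.
  by rewrite lt_min d0 ltr01 ge_min lexx orbT.
by apply: hU; [rewrite le_min (ltW d0) ler01 | rewrite ge_min lexx].
Qed.

Lemma is_faceP F : is_face A F <-> exists x, F = face x.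
Proof. by split=> -[x ->]; exists x; rewrite closure_stratum. Qed.

Lemma face_sub x y : face x `<=` face y <-> sle x y.
Proof.
split; first by move/(_ x); apply; exact: sle_refl.
by move=> xy z zx; exact: sle_trans zx xy.
Qed.

Lemma face_eq x y : face x = face y <-> sgeq x y.
Proof.
split=> [e|e]; first by apply: sle_anti; apply/face_sub; rewrite e.
by apply/seteqP; split; apply/face_sub/sgeq_sle => //; exact: sgeq_sym.
Qed.

Lemma supp_finite x : finite_set [set H | A H /\ sg H x = 0].
Proof.
have [U Ux fU] := hA.2 x; apply: sub_finite_set fU => H /= [AH hx]; split=> //.
by exists x; split; [apply/(sg_eq0 _ AH) | exact: nbhs_singleton].
Qed.

(** Near [x] only finitely many hyperplanes matter, so [d] is a minimum of finitely many bounds; any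
    other hyperplane changing sign along the ray would be met inside the chosen neighbourhood. *)
Lemma sg_ray x v : exists2 d : R, 0 < d & forall t, 0 < t -> t <= d ->
  forall H, A H ->
  sg H (x + t *: v) = if sg H x == 0 then Num.sg (lin H v) else sg H x.
Proof.
have [U Ux /finite_seqP[s sE]] := hA.2 x.
have [d d0 hU] := nbhs_ray v Ux.
have [d' d'0 hs] : exists2 d' : R, 0 < d' & forall t, 0 < t -> t <= d' ->
    forall H, A H -> H \in s -> sg H x != 0 -> sg H (x + t *: v) = sg H x.
  elim: s {sE} => [|K s [d1 d10 hs]]; first by exists 1.
  have [[AK K0]|nK] := pselect (A K /\ sg K x != 0); last first.
    exists d1 => // t t0 td H AH; rewrite inE => /predU1P[HK H0|]; last exact: hs.
    by case: nK; rewrite -HK.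
  have [d2 d20 h2] := nbhs_ray v (sg_near AK K0).
  exists (Num.min d1 d2); first by rewrite lt_min d10.
  move=> t t0; rewrite le_min => /andP[t1 t2] H AH.
  rewrite inE => /predU1P[-> _|]; last exact: hs.
  by apply: h2 => //; exact: ltW.
exists (Num.min d d') => [|t t0]; first by rewrite lt_min d0.
rewrite le_min => /andP[td td'] H AH; case: eqVneq => [hx|hx].
  have /eqP := hx; rewrite sgr_eq0 => /eqP hx0.
  by rewrite /sg evD hx0 add0r linZ sgrM gtr0_sg // mul1r.
have [Hs|Hs] := boolP (H \in s); first exact: hs.
apply: contrapT => /nesym/(sg_segment AH)[t' /andP[t'0 t'1]].
rewrite addrAC subrr add0r scalerA => Hx.
suff : H \in s by rewrite (negPf Hs).
have : [set` s] H.
  rewrite -sE; split=> //; exists (x + (t' * t) *: v); split=> //; apply: hU.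
    by apply: mulr_ge0 => //; exact: ltW.
  by apply: le_trans td; rewrite ler_piMl // ltW.
by [].
Qed.

(** On sign vectors this is the composition of covectors of an oriented matroid: the signs of [x]
    prevail, and those of the direction [v] fill in its zeros. *)
Definition loc x v : V := x + xget 1 [set d : R | 0 < d /\
  forall H, A H ->
  sg H (x + d *: v) = if sg H x == 0 then Num.sg (lin H v) else sg H x] *: v.

Lemma sg_loc x v H : A H ->
  sg H (loc x v) = if sg H x == 0 then Num.sg (lin H v) else sg H x.
Proof.
rewrite /loc; case: xgetP => [d _ [_ h]|no]; first exact: h.
have [d d0 h] := sg_ray x v; case: (no d); split=> // K; exact: h.
Qed.

End Signs.

(** * Bounds on the affine dimension *)

Section AffineDimension.
Variables (R : realType) (n : nat).
Local Notation V := 'rV[R]_n.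

Lemma aff_dim_hyperplane (S : set V) (a : V) (b : R) :
  a != 0 -> S `<=` hyperplane a b -> (aff_dim S < n)%N.
Proof.
move=> a0 Sab.
have ra : \rank a^T = 1%N by rewrite mxrank_tr rank_rV a0.
have n0 : (0 < n)%N by rewrite -ra; exact: rank_leq_row.
suff : (aff_dim S <= n.-1)%N by move/leq_ltn_trans; apply; rewrite ltn_predL.
apply/bigmax_leqP => k /asboolP[p [Sp]].
rewrite /aff_indep -row_leq_rank => rk; rewrite -ltnS (ltn_predK n0).
apply: leq_ltn_trans rk _.
set B := (X in \rank X).
have : B *m a^T = 0.
  apply/matrixP => i j; rewrite !mxE.
  rewrite [RHS](_ : 0 = dotp a (p (lift ord0 i) - p ord0)); last first.
    by rewrite dotpBr (Sab _ (Sp _)) (Sab _ (Sp _)) subrr.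
  by apply: eq_bigr => l _; rewrite !mxE ord1 mulrC.
by move=> /mulmx0_rank_max; rewrite ra addn1.
Qed.

Lemma aff_dim_ge (S : set V) (x : V) k (W : 'M[R]_(k, n)) :
  row_free W -> S x ->
  (forall i, exists2 t : R, 0 < t & S (x + t *: row i W)) -> (k <= aff_dim S)%N.
Proof.
move=> fW Sx h.
have kn : (k < n.+1)%N.
  by rewrite ltnS; have := rank_leq_col W; rewrite (eqP fW).
have {h}[t ht] : {t : 'I_k -> R & forall i, 0 < t i /\ S (x + t i *: row i W)}.
  by apply: (@choice _ _ (fun i t => 0 < t /\ S (x + t *: row i W))) => i;
     have [t t0 St] := h i; exists t.
rewrite /aff_dim (bigD1 (Ordinal kn)) /=; first exact: leq_maxl.
apply/asboolP; exists (fun i => if unlift ord0 i is Some j then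
   x + t j *: row j W else x); split=> [i|].
  by case: unlift => // j; case: (ht j).
rewrite /aff_indep.
have -> : \matrix_(i < k) ((if unlift ord0 (lift ord0 i) is Some j
      then x + t j *: row j W else x) - (if unlift ord0 (@ord0 k) is Some j
      then x + t j *: row j W else x)) = diag_mx (\row_i t i) *m W.
  apply/row_matrixP => i; rewrite rowK liftK unlift_none row_mul.
  rewrite addrAC subrr add0r row_diag_mx mxE -scalemxAl.
  by rewrite rowE.
have uD : diag_mx (\row_i t i) \in unitmx.
  rewrite unitmxE det_diag unitfE; apply/prodf_neq0 => i _.
  by rewrite mxE gt_eqF //; case: (ht i).
by rewrite -row_leq_rank (eqmxMfull W (_ : row_full _)) ?row_full_unit // row_leq_rank.
Qed.

End AffineDimension.

(** * Chambers, separation, and the chambers [C.F] and [C^F] by signs *)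

Section Chambers.
Variables (R : realType) (n : nat) (A : set (set 'rV[R]_n)).
Hypothesis hA : is_arrangement A.
Local Notation V := 'rV[R]_n.
Local Notation sle := (sle A).
Local Notation sgeq := (sgeq A).
Local Notation face := (face A).
Local Notation loc := (loc A).
Implicit Types (H : set V) (x y z v w c d f g : V).

Definition chamber_pt x := forall H, A H -> sg H x != 0.

Lemma sub_hyperplaneE x H : A H -> face x `<=` H <-> sg H x = 0.
Proof.
move=> AH; split=> [h|hx y yx].
  by apply/(sg_eq0 hA _ AH); apply: h; exact: sle_refl.
by apply/(sg_eq0 hA _ AH); case: (yx H AH) => // ->.
Qed.

Lemma is_chamberE x : is_chamber A (face x) <-> chamber_pt x.
Proof.
split=> [[_ c0] H AH|hx].
  apply/eqP => /(sub_hyperplaneE x AH); have [a0 HE] := normalP hA AH.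
  rewrite [X in _ `<=` X]HE => /(aff_dim_hyperplane a0); rewrite -subn_gt0.
  by move: c0; rewrite /codim => ->.
split; first by apply/(is_faceP hA); exists x.
apply/eqP; rewrite subn_eq0; apply: (@aff_dim_ge _ _ _ x _ 1%:M).
- by rewrite row_free_unit unitmx1.
- exact: sle_refl.
- move=> i; have [d d0 hd] := sg_ray hA x (row i 1%:M); exists d => // H AH.
  by rewrite hd // (negPf (hx H AH)); right.
Qed.

(** Every direction in the kernel of [lin H1], a space of dimension [n - 1], stays in the face for a
    short time. This identifies the edges of the Salvetti complex, to which the third incidence
    axiom applies. *)
Lemma codim_wall x H1 : A H1 -> sg H1 x = 0 ->
  (forall v H, A H -> sg H x = 0 -> lin H1 v = 0 -> lin H v = 0) ->
  codim (face x) = 1%N.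
Proof.
move=> AH hx hp; have [a0 HE] := normalP hA AH.
have ra : \rank (normal H1)^T = 1%N by rewrite mxrank_tr rank_rV a0.
have n0 : (0 < n)%N by rewrite -ra; exact: rank_leq_row.
have lt_n : (aff_dim (face x) < n)%N.
  apply: (aff_dim_hyperplane a0 (b := offset H1)); rewrite -HE.
  exact/sub_hyperplaneE.
have ge_n : (n.-1 <= aff_dim (face x))%N.
  have -> : n.-1 = \rank (kermx (normal H1)^T) by rewrite mxrank_ker ra subn1.
  apply: (@aff_dim_ge _ _ _ x _ (row_base (kermx (normal H1)^T))).
  - exact: row_base_free.
  - exact: sle_refl.
  - move=> i; set v := row _ _.
    have v0 : lin H1 v = 0.
      have : (v <= kermx (normal H1)^T)%MS.
        by apply: submx_trans (row_sub _ _) _; rewrite eq_row_base.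
      move/sub_kermxP/matrixP/(_ 0 0); rewrite !mxE => e.
      by rewrite -[RHS]e /lin /dotp; apply: eq_bigr => j _; rewrite !mxE mulrC.
    have [d d0 hd] := sg_ray hA x v; exists d => // H AH'.
    rewrite hd //; case: eqVneq => [h0|]; last by right.
    by left; rewrite (hp v H) ?sgr0.
by rewrite /codim; lia.
Qed.

Lemma ev_face_le0 H x z : A H -> sg H x = -1 -> face x z -> ev H z <= 0.
Proof.
move=> AH hx zx; have := zx H AH; rewrite hx /sg.
by case: (sgE (ev H z)) => -[hz ->]; lra.
Qed.

Lemma ev_face_ge0 H x z : A H -> sg H x = 1 -> face x z -> 0 <= ev H z.
Proof.
move=> AH hx zx; have := zx H AH; rewrite hx /sg.
by case: (sgE (ev H z)) => -[hz ->]; lra.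
Qed.

Lemma sepE x y H : chamber_pt x -> chamber_pt y ->
  sep A (face x) (face y) H <-> A H /\ sg H x <> sg H y.
Proof.
move=> cx cy; split=> [[AH [a [b [a0 HE hx hy]]]]|[AH]].
  split=> // /(same_sign_same_side hA AH (cx H AH)) ss.
  have ax : dotp a x < b.
    rewrite lt_neqAle (hx x) ?andbT; last exact: sle_refl.
    apply/eqP => ab; move/eqP: (cx H AH); apply; apply/(sg_eq0 hA _ AH).
    by rewrite HE.
  have ay : b < dotp a y.
    rewrite lt_neqAle (hy y) ?andbT; last exact: sle_refl.
    apply/eqP => ab; move/eqP: (cy H AH); apply; apply/(sg_eq0 hA _ AH).
    by rewrite HE /hyperplane /= -ab.
  have [] := @segment_same_side _ _ H x y ((b - dotp a x) / (dotp a y - dotp a x)) ss.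
    clear HE; rewrite divr_ge0 ?ler_pdivrMr //=; lra.
  rewrite HE /hyperplane /= dotpDr dotpZr dotpBr divfK ?gt_eqF ?subr_gt0 //.
    by rewrite addrC subrK.
  exact: lt_trans ay.
have [a0 HE] := normalP hA AH.
have := cx H AH; have := cy H AH.
case: (sgE (ev H x)) => -[_ sx]; case: (sgE (ev H y)) => -[_ sy];
  rewrite ?(sx : sg H x = _) ?(sy : sg H y = _) ?eqxx // => _ _ _; split=> //.
- exists (normal H), (offset H); split=> // z zx.
    by rewrite -subr_le0; exact: ev_face_le0 AH sx zx.
  by rewrite -subr_ge0; exact: ev_face_ge0 AH sy zx.
- exists (- normal H), (- offset H); rewrite hyperplaneN oppr_eq0.
  split=> // z zx; rewrite dotpNl lerN2.
    by rewrite -subr_ge0; exact: ev_face_ge0 AH sx zx.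
  by rewrite -subr_le0; exact: ev_face_le0 AH sy zx.
Qed.

Lemma suppE x H : supp A (face x) H <-> A H /\ sg H x = 0.
Proof. by split=> -[AH h]; split=> //; apply/(sub_hyperplaneE x AH). Qed.

(** On hyperplanes through [f], the direction [c - f] has the sign of [c]; small moves along it and
    along its opposite thus represent [C.F] and [C^F]. *)
Definition at_pt c f : V := loc f (c - f).
Definition opp_pt c f : V := loc f (f - c).

Lemma sg_at c f H : A H ->
  sg H (at_pt c f) = if sg H f == 0 then sg H c else sg H f.
Proof.
move=> AH; rewrite sg_loc //; case: eqVneq => // /eqP; rewrite sgr_eq0 => /eqP h.
by rewrite lin_ev h subr0.
Qed.

Lemma sg_opp c f H : A H ->
  sg H (opp_pt c f) = if sg H f == 0 then - sg H c else sg H f.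
Proof.
move=> AH; rewrite sg_loc //; case: eqVneq => // /eqP; rewrite sgr_eq0 => /eqP h.
by rewrite lin_ev h sub0r sgrN.
Qed.

Lemma at_chamber c f : chamber_pt c -> chamber_pt (at_pt c f).
Proof. by move=> cc H AH; rewrite sg_at //; case: (eqVneq (sg H f) 0) => // _; rewrite cc. Qed.

Lemma sle_at c f : sle f (at_pt c f).
Proof. by move=> H AH; rewrite sg_at //; case: eqVneq => [->|_]; [left|right]. Qed.

Lemma opp_chamber_pt c f : chamber_pt c -> chamber_pt (opp_pt c f).
Proof.
by move=> cc H AH; rewrite sg_opp //; case: (eqVneq (sg H f) 0) => // _; rewrite oppr_eq0 cc.
Qed.

Lemma sle_opp c f : sle f (opp_pt c f).
Proof. by move=> H AH; rewrite sg_opp //; case: eqVneq => [->|_]; [left|right]. Qed.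

Lemma chamber_atE c f : chamber_pt c ->
  chamber_at A (face c) (face f) = face (at_pt c f).
Proof.
move=> cc; apply: get_unique => [|D [[/(is_faceP hA)[d ->] cd] fd sd]].
  split; first exact/is_chamberE/at_chamber.
    exact/face_sub/sle_at.
  apply/seteqP; split=> // H [/suppE[AH h0] /sepE[||_]] //; first exact: at_chamber.
  by rewrite sg_at // h0 eqxx.
have {cd}cd : chamber_pt d.
  by apply/is_chamberE; split=> //; apply/(is_faceP hA); exists d.
apply/face_eq => H AH; rewrite sg_at //; case: eqVneq => h0; last first.
  by case: ((face_sub A f d).1 fd H AH) => [e|->//]; rewrite e eqxx in h0.
apply: contrapT => ne; suff : set0 H by [].
rewrite -sd; split; first exact/suppE.
by apply/sepE => //; split=> //; exact: nesym.
Qed.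

Lemma opp_chamberE c f : chamber_pt c -> sle f c ->
  opp_chamber A (face c) (face f) = face (opp_pt c f).
Proof.
move=> cc fc; apply: get_unique => [|D [[/(is_faceP hA)[d ->] cd] fd sd]].
  split; first exact/is_chamberE/opp_chamber_pt.
    exact/face_sub/sle_opp.
  apply/seteqP; split=> H.
    move=> /sepE[||AH]//; first exact: opp_chamber_pt.
    move=> h; apply/suppE; split=> //; apply: contrapT => /eqP h0; apply: h.
    by rewrite sg_opp // (negPf h0); case: (fc H AH) => // e; rewrite e eqxx in h0.
  move=> /suppE[AH h0]; apply/sepE => //; first exact: opp_chamber_pt.
  split=> //; rewrite sg_opp // h0 eqxx => /eqP; rewrite -addr_eq0 -mulr2n.
  by rewrite mulrn_eq0 /=; apply/negP/cc.
have {cd}cd : chamber_pt d.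
  by apply/is_chamberE; split=> //; apply/(is_faceP hA); exists d.
apply/face_eq => H AH; rewrite sg_opp //; case: eqVneq => h0; last first.
  by case: ((face_sub A f d).1 fd H AH) => [e|->//]; rewrite e eqxx in h0.
have : supp A (face f) H by apply/suppE.
rewrite -sd => /sepE[//|//|_].
have := cc H AH; have := cd H AH.
rewrite /sg; case: (sgE (ev H c)) => -[_ ->]; case: (sgE (ev H d)) => -[_ ->];
  rewrite ?eqxx ?opprK //.
Qed.

End Chambers.

(** * Covering relations between faces *)

Lemma seq_argmin (R : realType) (T : eqType) (r : T -> R) (s : seq T) (P : pred T) (x : T) :
  x \in s -> P x -> exists y, [/\ y \in s, P y & forall z, z \in s -> P z -> r y <= r z].
Proof.
elim: s x => // a s IH x; rewrite inE.
have [[y [ys Py]] _ _|no xs Px] := pselect (exists y, y \in s /\ P y); last first.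
  exists a; move/predU1P: xs => [<-|xs]; last by case: no; exists x.
  split=> //; rewrite ?mem_head // => z; rewrite inE => /predU1P[->//|zs Pz].
  by case: no; exists z.
have [z [zs Pz zmin]] := IH y ys Py.
have [Pa|Pa] := boolP (P a); last first.
  exists z; split; rewrite ?inE ?zs ?orbT // => t; rewrite inE => /predU1P[->|].
    by rewrite (negPf Pa).
  exact: zmin.
have [ra|ra] := leP (r a) (r z).
  exists a; split; rewrite ?mem_head // => t; rewrite inE => /predU1P[->//|ts Pt].
  exact: le_trans (zmin t ts Pt).
exists z; split; rewrite ?inE ?zs ?orbT // => t; rewrite inE => /predU1P[-> _|].
  exact: ltW.
exact: zmin.
Qed.

Section Covers.
Variables (R : realType) (n : nat) (A : set (set 'rV[R]_n)).
Hypothesis hA : is_arrangement A.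
Local Notation V := 'rV[R]_n.
Local Notation sle := (sle A).
Local Notation sgeq := (sgeq A).
Local Notation face := (face A).
Local Notation loc := (loc A).
Implicit Types (H : set V) (x y z u v w f g h k : V).

Lemma sle_loc f u : sle f (loc f u).
Proof. by move=> H AH; rewrite sg_loc //; case: eqVneq => [->|_]; [left|right]. Qed.

Lemma loc_sle f u k : sle f k ->
  (forall H, A H -> sg H f = 0 ->
     Num.sg (lin H u) = 0 \/ Num.sg (lin H u) = sg H k) -> sle (loc f u) k.
Proof.
move=> fk h H AH; rewrite sg_loc //; case: eqVneq => [|/eqP h0]; first exact: h.
exact: fk.
Qed.

Lemma sg_loc0 f u H : A H -> sg H f = 0 -> sg H (loc f u) = Num.sg (lin H u).
Proof. by move=> AH h0; rewrite sg_loc // h0 eqxx. Qed.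

Lemma sg_diff f k H : A H -> sg H f = 0 -> Num.sg (lin H (k - f)) = sg H k.
Proof. by move=> AH /eqP; rewrite sgr_eq0 => /eqP h0; rewrite lin_ev h0 subr0. Qed.

Lemma sg0_ev H x : sg H x = 0 -> ev H x = 0.
Proof. by move/eqP; rewrite sgr_eq0 => /eqP. Qed.

(** A ratio test: among the finitely many hyperplanes through [f] that [u] approaches when moved
    along [v], [H1] is reached first, so no sign has been reversed by then. The last hypothesis
    keeps the zeros of [u]. *)
Lemma first_hit f u v H2 : A H2 -> sg H2 f = 0 -> lin H2 u * lin H2 v < 0 ->
  (forall H, A H -> sg H f = 0 -> lin H u = 0 -> lin H v = 0) ->
  exists s H1, [/\ 0 < s, A H1 /\ sg H1 f = 0, lin H1 u <> 0,
    lin H1 (u + s *: v) = 0 &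
    forall H, A H -> sg H f = 0 -> Num.sg (lin H (u + s *: v)) = 0 \/
      Num.sg (lin H (u + s *: v)) = Num.sg (lin H u)].
Proof.
move=> AH2 h2 uv2 huv.
have /finite_seqP[l lE] := supp_finite hA f.
have inl H : H \in l <-> A H /\ sg H f = 0.
  have : [set H | A H /\ sg H f = 0] H = [set` l] H by rewrite lE.
  by move=> /= ->.
have [H1 [/inl[AH1 h1] uv1 min1]] := @seq_argmin _ _ (fun H => - lin H u / lin H v) l
  (fun H => lin H u * lin H v < 0) H2 ((inl _).2 (conj AH2 h2)) uv2.
have v1 : lin H1 v != 0 by apply/eqP => e; rewrite e mulr0 ltxx in uv1.
exists (- lin H1 u / lin H1 v), H1; set s := - lin H1 u / lin H1 v.
have s0 : 0 < s.
  have -> : s = - (lin H1 u * lin H1 v) / (lin H1 v * lin H1 v) by rewrite /s; field.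
  by rewrite divr_gt0 ?oppr_gt0 // -expr2 exprn_even_gt0.
split=> //.
- by move=> e; rewrite e mul0r ltxx in uv1.
- by rewrite linD linZ /s divfK // subrr.
- move=> H AH h0; rewrite linD linZ.
  have := huv H AH h0; have := min1 H ((inl _).2 (conj AH h0)); rewrite -/s.
  set a := lin H u; set b := lin H v => hm hz.
  case: (sgE a) => -[ha ->].
  + have ab : a + s * b <= 0.
      have [hb|hb] := leP b 0; first by have := mulr_ge0_le0 (ltW s0) hb; lra.
      by move: hm; rewrite (nmulr_rlt0 _ ha) hb ler_pdivlMr // => /(_ isT); lra.
    by case: (sgE (a + s * b)) => -[hs ->]; [right|left|lra].
  + by left; rewrite hz // ha mulr0 addr0 sgr0.
  + have ab : 0 <= a + s * b.
      have [hb|hb] := leP 0 b; first by have := mulr_ge0 (ltW s0) hb; lra.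
      by move: hm; rewrite (pmulr_rlt0 _ ha) hb ler_ndivlMr // => /(_ isT); lra.
    by case: (sgE (a + s * b)) => -[hs ->]; [lra|left|right].
Qed.

Definition fcov f k := [/\ sle f k, ~ sgeq f k &
  forall x, sle f x -> sle x k -> sgeq x f \/ sgeq x k].

(* When [k] covers [f], the face of [f] has codimension one in that of [k]: all
   functionals vanishing at [f] are proportional on the directions of [k]. *)
Lemma fcov_lin f k H1 v : fcov f k -> A H1 -> sg H1 f = 0 -> sg H1 k <> 0 ->
  (forall H, A H -> sg H k = 0 -> lin H v = 0) -> lin H1 v = 0 ->
  forall H, A H -> sg H f = 0 -> lin H v = 0.
Proof.
move=> [fk nfk mid] AH1 h1 k1 Wv v1 H2 AH2 h2; apply/eqP/negPn/negP => v2.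
have k2 : lin H2 (k - f) != 0.
  rewrite lin_ev (sg0_ev h2) subr0; apply/eqP => e; move/eqP: v2; apply; apply: Wv => //.
  by rewrite /sg e sgr0.
pose v' := if lin H2 (k - f) * lin H2 v < 0 then v else - v.
have lv' H : lin H v = 0 -> lin H v' = 0.
  by rewrite /v'; case: ifP => // _ e; rewrite linN e oppr0.
have uv2 : lin H2 (k - f) * lin H2 v' < 0.
  rewrite /v'; case: ifP => // /negbT; rewrite -leNgt linN mulrN oppr_lt0 => h.
  by rewrite lt_neqAle h andbT eq_sym mulf_neq0.
have hz H : A H -> sg H f = 0 -> lin H (k - f) = 0 -> lin H v' = 0.
  move=> AH h0; rewrite lin_ev (sg0_ev h0) subr0 => e; apply: lv'; apply: Wv => //.
  by rewrite /sg e sgr0.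
have [s [H3 [s0 [AH3 h3] u3 w3 sl]]] := first_hit AH2 h2 uv2 hz.
(* This face would be strictly between [f] and [k]: the move along [v'] does not change [lin H1], so
   it is not [f], and [H3] contains it but not [k]. *)
pose x := loc f (k - f + s *: v').
have xk : sle x k.
  by apply: loc_sle => // H AH h0; rewrite -(sg_diff k AH h0); exact: sl.
case: (mid x (sle_loc _ _) xk) => e.
- have := e H1 AH1; rewrite sg_loc0 // h1 linD linZ (lv' _ v1) mulr0 addr0 sg_diff //.
- have := e H3 AH3; rewrite sg_loc0 // w3 sgr0 -(sg_diff k AH3 h3).
  by move/esym/eqP; rewrite sgr_eq0 => /eqP.
Qed.

(** The combination [v] is killed by [H1] and by the hyperplanes containing [k], hence by all those
    through [f]. So the values at [k] and [g] are proportional, and the ratio is positive because it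
    is so at [H1]. *)
Lemma fcov_facet_uniq f k g H1 : fcov f k -> fcov f g ->
  (forall H, A H -> sg H k = 0 <-> sg H g = 0) ->
  A H1 -> sg H1 f = 0 -> sg H1 k <> 0 -> sg H1 g = sg H1 k -> sgeq g k.
Proof.
move=> fk fg kg AH1 h1 k1 g1 H AH.
have [fleqk _ _] := fk; have [fleqg _ _] := fg.
have [h0|h0] := pselect (sg H f = 0); last first.
  by case: (fleqk H AH) => // <-; case: (fleqg H AH).
pose a x := ev H1 x; pose v := a g *: (k - f) - a k *: (g - f).
have v1 : lin H1 v = 0.
  by rewrite /v linB !linZ !lin_ev (sg0_ev h1) /a; ring.
have Wv H' : A H' -> sg H' k = 0 -> lin H' v = 0.
  move=> AH' k0; have g0 := (kg H' AH').1 k0.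
  have f0 : sg H' f = 0 by case: (fleqk H' AH') => // ->.
  by rewrite /v linB !linZ !lin_ev (sg0_ev k0) (sg0_ev g0) (sg0_ev f0); ring.
have := fcov_lin fk AH1 h1 k1 Wv v1 AH h0.
rewrite /v linB !linZ !lin_ev (sg0_ev h0) !subr0 => /subr0_eq e.
have := congr1 Num.sg e; rewrite !sgrM -/(sg H k) -/(sg H g) /a -/(sg H1 k) -/(sg H1 g).
by rewrite g1 => /(mulfI _) ->//; exact/eqP.
Qed.

(** Both flats are the intersection of [H1] with the common flat of [k] and [g]: the difference
    [f - h] is a direction of that flat killed by [H1]. *)
Lemma fcov_same_flat f k h g H1 : fcov f k -> fcov h g ->
  (forall H, A H -> sg H k = 0 <-> sg H g = 0) ->
  A H1 -> sg H1 k <> 0 -> sg H1 f = 0 -> sg H1 h = 0 ->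
  forall H, A H -> sg H h = 0 <-> sg H f = 0.
Proof.
move=> fk hg kg AH1 k1 f1 h1.
have [fleqk _ _] := fk; have [hleqg _ _] := hg.
have z H : A H -> sg H k = 0 -> sg H f = 0 /\ sg H h = 0.
  move=> AH k0; have g0 := (kg H AH).1 k0.
  by split; [case: (fleqk H AH) => // -> | case: (hleqg H AH) => // ->].
have g1 : sg H1 g <> 0 by move/(kg H1 AH1).2.
move=> H AH; split=> h0.
- have : lin H (f - h) = 0.
    apply: (fcov_lin hg AH1 h1 g1) => // [H' AH' /(kg H' AH').2/(z _ AH')[e1 e2]|].
      by rewrite lin_ev (sg0_ev e1) (sg0_ev e2) subrr.
    by rewrite lin_ev (sg0_ev f1) (sg0_ev h1) subrr.
  by rewrite lin_ev (sg0_ev h0) subr0 /sg => ->; rewrite sgr0.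
- have : lin H (h - f) = 0.
    apply: (fcov_lin fk AH1 f1 k1) => // [H' AH' /(z _ AH')[e1 e2]|].
      by rewrite lin_ev (sg0_ev e1) (sg0_ev e2) subrr.
    by rewrite lin_ev (sg0_ev f1) (sg0_ev h1) subrr.
  by rewrite lin_ev (sg0_ev h0) subr0 /sg => ->; rewrite sgr0.
Qed.

Lemma sg_reflect h x H : A H ->
  sg H (loc h (h - x)) = if sg H h == 0 then - sg H x else sg H h.
Proof.
move=> AH; rewrite sg_loc //; case: eqVneq => // h0.
by rewrite -opprB linN sgrN sg_diff.
Qed.

(** Reflection in the point [h] reverses the signs on hyperplanes through [h]; being an involution
    on the faces above [h], it preserves covers. *)
Lemma fcov_reflect h g : fcov h g ->
  exists g', [/\ fcov h g', ~ sgeq g' g & forall H, A H -> sg H g' = 0 <-> sg H g = 0].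
Proof.
move=> [hg nhg mid]; exists (loc h (h - g)).
have nsg (r : R) : - r = 0 <-> r = 0.
  by split=> [/eqP|->]; rewrite ?oppr0 // oppr_eq0 => /eqP.
have z H : A H -> sg H (loc h (h - g)) = 0 <-> sg H g = 0.
  move=> AH; rewrite sg_reflect //; case: eqVneq => [_|h0]; first exact: nsg.
  by case: (hg H AH) => [e|->//]; rewrite e eqxx in h0.
have [H1 [AH1 ne1]] : exists H, A H /\ sg H h <> sg H g.
  by apply: contrapT => no; apply: nhg => H AH; apply: contrapT => ne; apply: no; exists H.
have h1 : sg H1 h = 0 by case: (hg H1 AH1).
split=> //; last first.
  move/(_ H1 AH1); rewrite sg_reflect // h1 eqxx => e.
  by apply: ne1; rewrite h1; lra.
split; first exact: sle_loc.
  by move/(_ H1 AH1)/esym; rewrite h1 z // => e; apply: ne1; rewrite h1 e.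
move=> x hx xg'; pose x' := loc h (h - x).
have x'g : sle x' g.
  apply: loc_sle => // H AH h0; rewrite -opprB linN sgrN sg_diff //.
  case: (xg' H AH) => [->|->]; first by left; rewrite oppr0.
  by right; rewrite sg_reflect // h0 eqxx opprK.
case: (mid x' (sle_loc _ _) x'g) => e; [left|right] => H AH; have := e H AH;
  rewrite !sg_reflect //; case: eqVneq => [h0|h0] //.
- by rewrite h0 => /nsg.
- by case: (hx H AH) => [hh|->//]; rewrite hh eqxx in h0.
- by move=> <-; rewrite opprK.
- by case: (hx H AH) => [hh|->//]; rewrite hh eqxx in h0.
Qed.

End Covers.

(** * Intervals of length two in the face poset *)

Section Thin.
Variables (R : realType) (n : nat) (A : set (set 'rV[R]_n)).
Hypothesis hA : is_arrangement A.
Local Notation V := 'rV[R]_n.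
Local Notation sle := (sle A).
Local Notation sgeq := (sgeq A).
Local Notation face := (face A).
Local Notation loc := (loc A).
Local Notation fcov := (fcov A).
Implicit Types (H : set V) (x y z u v w f g h k : V).

Lemma sle_zero x y H : sle x y -> A H -> sg H y = 0 -> sg H x = 0.
Proof. by move=> xy AH y0; case: (xy H AH) => // ->. Qed.

Lemma sle_nonzero x y H : sle x y -> A H -> sg H x <> 0 -> sg H y = sg H x.
Proof. by move=> xy AH x0; case: (xy H AH). Qed.

Lemma neq_sle_wall x y : sle x y -> ~ sgeq x y ->
  exists H, [/\ A H, sg H x = 0 & sg H y <> 0].
Proof.
move=> xy nxy; apply: contrapT => no; apply: nxy => H AH.
case: (xy H AH) => // x0; apply: contrapT => ne; apply: no; exists H; split=> // y0.
by apply: ne; rewrite x0 y0.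
Qed.

(* Starting from [k], rotate towards the opposite of [g] until a hyperplane
   through [h] not containing [g] is reached. *)
Lemma fcov_thin h g k : fcov h g -> fcov g k ->
  exists g', [/\ fcov h g', fcov g' k & ~ sgeq g' g].
Proof.
move=> hg gk; have [hleg nhg _] := hg; have [glek ngk _] := gk.
have hlek := sle_trans hleg glek.
pose u := g - h; pose w := k - h.
have su H : A H -> sg H h = 0 -> Num.sg (lin H u) = sg H g by exact: sg_diff.
have sw H : A H -> sg H h = 0 -> Num.sg (lin H w) = sg H k by exact: sg_diff.
have lu0 H : A H -> sg H h = 0 -> (lin H u = 0 <-> sg H g = 0).
  by move=> AH h0; rewrite -su //; split=> [->|/eqP]; rewrite ?sgr0 // sgr_eq0 => /eqP.
have lw0 H : A H -> sg H h = 0 -> (lin H w = 0 <-> sg H k = 0).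
  by move=> AH h0; rewrite -sw //; split=> [->|/eqP]; rewrite ?sgr0 // sgr_eq0 => /eqP.
have [P [AP Pg Pk]] := neq_sle_wall glek ngk.
have [Q [AQ Qh Qg]] := neq_sle_wall hleg nhg.
have Ph := sle_zero hleg AP Pg.
have wz H : A H -> sg H h = 0 -> lin H w = 0 -> lin H (- u) = 0.
  move=> AH h0 /(lw0 H AH h0) k0; rewrite linN (_ : lin H u = 0) ?oppr0 //.
  exact/lu0/(sle_zero glek).
have hitQ : lin Q w * lin Q (- u) < 0.
  rewrite linN mulrN oppr_lt0 -sgr_gt0 sgrM su // sw // (sle_nonzero glek) //.
  by rewrite -expr2 lt_neqAle sqr_ge0 andbT eq_sym expf_neq0 //; exact/eqP.
have [s [S [s0 [AS Sh] Sw vS sv]]] := first_hit hA AQ Qh hitQ wz.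
set v := w + s *: - u in vS sv.
have lv H : lin H v = lin H w - s * lin H u by rewrite /v linD linZ linN mulrN.
have Su : lin S u <> 0.
  by move=> e; apply: Sw; move: vS; rewrite lv e mulr0 subr0.
have Sg : sg S g <> 0 by move/(lu0 S AS Sh).
pose g' := loc h v.
have hg' : sle h g' by exact: sle_loc.
have g'k : sle g' k.
  by apply: (loc_sle hA hlek) => H AH h0; rewrite -sw //; exact: sv.
have Pu : lin P u = 0 by apply/lu0.
have Pw : lin P w <> 0 by move/(lw0 P AP Ph).
have Pv : lin P v = lin P w by rewrite lv Pu mulr0 subr0.
have sg'0 H : A H -> sg H h = 0 -> sg H g' = Num.sg (lin H v) by exact: sg_loc0.
have Sg' : sg S g' = 0 by rewrite sg'0 // vS sgr0.
(* The faces above [h] in the plane spanned by [v] and [u] modulo the flat of [h]. *)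
have decomp x : sle h x -> sle x k -> exists a b, forall H, A H -> sg H h = 0 ->
    ev H x = a * lin H v + b * lin H u.
  move=> hx xk.
  pose a := ev P x / lin P w; pose x1 := x - h - a *: w.
  have lx H : A H -> sg H h = 0 -> lin H (x - h) = ev H x.
    by move=> AH h0; rewrite lin_ev (sg0_ev h0) subr0.
  have x1z H : A H -> sg H g = 0 -> lin H x1 = 0.
    apply: (fcov_lin hA gk AP Pg Pk) => [H' AH' k0|].
      have h0 := sle_zero hlek AH' k0.
      rewrite linB linZ (lw0 _ AH' h0).2 // mulr0 subr0 lx //.
      exact/sg0_ev/(sle_zero xk).
    by rewrite linB linZ lx // /a divfK ?subrr //; exact/eqP.
  pose b := lin S x1 / lin S u; pose x2 := x1 - b *: u.
  have x2z H : A H -> sg H h = 0 -> lin H x2 = 0.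
    apply: (fcov_lin hA hg AS Sh Sg) => [H' AH' g0|].
      rewrite linB linZ x1z // (lu0 _ AH' (sle_zero hleg AH' g0)).2 //.
      by rewrite mulr0 subr0.
    by rewrite linB linZ /b divfK ?subrr //; exact/eqP.
  exists a, (b + a * s) => H AH h0; have := x2z H AH h0.
  by rewrite /x2 linB /x1 linB !linZ lx // lv => e; lra.
have sgD (a b : R) (r : R) : (Num.sg a = 0 \/ Num.sg a = r) ->
    (Num.sg b = 0 \/ Num.sg b = r) -> (a <> 0 \/ b <> 0) -> Num.sg (a + b) = r.
  move=> ea eb ne; have [a0|a0] := eqVneq a 0.
    rewrite a0 add0r; case: eb => // /eqP; rewrite sgr_eq0 => /eqP b0.
    by case: ne.
  have ra : Num.sg a = r by case: ea => // /eqP; rewrite sgr_eq0 (negPf a0).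
  have [b0|b0] := eqVneq b 0; first by rewrite b0 addr0.
  have rb : Num.sg b = r by case: eb => // /eqP; rewrite sgr_eq0 (negPf b0).
  have [ha|ha|ha] := ltgtP a 0; last by rewrite ha eqxx in a0.
    have hb : b < 0 by rewrite -sgr_lt0 rb -ra sgr_lt0.
    by rewrite -ra !ltr0_sg //; lra.
  have hb : 0 < b by rewrite -sgr_gt0 rb -ra sgr_gt0.
  by rewrite -ra !gtr0_sg //; lra.
(* [P] vanishes on [u] and [S] on [v], so these two hyperplanes read off the signs of the
   coordinates [a] and [b] of a face. *)
exists g'; split.
- split=> //; first by move/(_ P AP)/esym; rewrite Ph sg'0 // Pv => /eqP;
    rewrite sgr_eq0 => /eqP.
  move=> x hx xg'; have [a [b ab]] := decomp x hx (sle_trans xg' g'k).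
  have b0 : b = 0.
    have := sg0_ev (sle_zero xg' AS Sg'); rewrite ab // vS mulr0 add0r => /eqP.
    by rewrite mulf_eq0 => /orP[/eqP//|/eqP].
  have xs H : A H -> sg H h = 0 -> sg H x = Num.sg a * Num.sg (lin H v).
    by move=> AH h0; rewrite /sg ab // b0 mul0r addr0 sgrM.
  have ext y : sle h y -> (forall H, A H -> sg H h = 0 -> sg H x = sg H y) -> sgeq x y.
    move=> hy e H AH; have [h0|h0] := pselect (sg H h = 0); first exact: e.
    by rewrite (sle_nonzero hx) // (sle_nonzero hy).
  case: (sgE a) => -[ha sa].
  + exfalso; case: (xg' P AP); rewrite xs // ?sg'0 // sa ?mulN1r => /eqP.
      by rewrite oppr_eq0 sgr_eq0 Pv => /eqP.
    rewrite -subr_eq0 -opprD oppr_eq0 -mulr2n mulrn_eq0 sgr_eq0 Pv => /eqP.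
    exact: Pw.
  + by left; apply: ext => [|H AH h0]; [exact: sle_refl | rewrite xs // sa mul0r h0].
  + by right; apply: ext => // H AH h0; rewrite xs // sa mul1r sg'0.
- split=> //.
    by move/(_ S AS); rewrite Sg' -(sw S AS Sh) => /esym/eqP; rewrite sgr_eq0 => /eqP.
  move=> x g'x xk; have hx := sle_trans hg' g'x.
  have [a [b ab]] := decomp x hx xk.
  have ext y : sle h y -> (forall H, A H -> sg H h = 0 -> sg H x = sg H y) -> sgeq x y.
    move=> hy e H AH; have [h0|h0] := pselect (sg H h = 0); first exact: e.
    by rewrite (sle_nonzero hx) // (sle_nonzero hy).
  have a0 : 0 < a.
    have Pg' : sg P g' <> 0.
      by rewrite sg'0 // Pv => /eqP; rewrite sgr_eq0 => /eqP.
    have := sle_nonzero g'x AP Pg'; rewrite sg'0 // /sg ab // Pu mulr0 addr0 sgrM.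
    have : Num.sg (lin P v) != 0 by rewrite sgr_eq0 Pv; exact/eqP.
    by case: (sgE a) => -[ha ->] // /eqP ne e; exfalso; apply: ne; lra.
  have sa : Num.sg a = 1 by rewrite gtr0_sg.
  have sS : Num.sg (lin S u) = sg S k by rewrite su // (sle_nonzero glek).
  have b0 : 0 <= b.
    have Sk : sg S k != 0 by rewrite (sle_nonzero glek) //; exact/eqP.
    have [//|hb] := leP 0 b; exfalso; move: (xk S AS).
    rewrite {1 2}/sg ab // vS mulr0 add0r sgrM sS ltr0_sg // mulN1r => -[] /eqP.
      by rewrite oppr_eq0 (negPf Sk).
    by rewrite -subr_eq0 -opprD oppr_eq0 -mulr2n mulrn_eq0 (negPf Sk).
  have [b00|b00] := eqVneq b 0.
    left; apply: ext => // H AH h0.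
    by rewrite /sg ab // b00 mul0r addr0 sgrM sa mul1r -/(sg H g') sg'0.
  have sb : Num.sg b = 1 by rewrite gtr0_sg // lt_neqAle eq_sym b00.
  right; apply: ext => // H AH h0; rewrite [LHS]/sg ab //.
  have [k0|k0] := pselect (sg H k = 0).
    have g0 := sle_zero glek AH k0.
    by rewrite lv (lw0 H AH h0).2 // (lu0 H AH h0).2 // k0 !mulr0 subrr mulr0 addr0 sgr0.
  apply: sgD.
  + by rewrite sgrM sa mul1r; have := sv H AH h0; rewrite sw.
  + by rewrite sgrM sb mul1r su //; exact: glek.
  + apply: contrapT => /not_orP[/contrapT av /contrapT bu].
    move/eqP: av; rewrite mulf_eq0 gt_eqF //= => /eqP av.
    move/eqP: bu; rewrite mulf_eq0 (negPf b00) /= => /eqP bu.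
    by apply: k0; rewrite -(lw0 H AH h0); move: av; rewrite lv bu mulr0 subr0.
- by move/(_ S AS); rewrite Sg' => /esym.
Qed.

(** It stands in for the codimension: it drops strictly from a face to a larger one, which suffices
    for inductions. *)
Definition wall_count x : nat := (#|` fset_set [set H | A H /\ sg H x = 0]|)%fset.

Lemma wall_count_lt x y : sle x y -> ~ sgeq x y -> (wall_count y < wall_count x)%N.
Proof.
move=> xy nxy; have fx := supp_finite hA x; have fy := supp_finite hA y.
apply/fproper_ltn_card/andP; split.
  apply/fsubsetP => H; rewrite (in_fset_set fx) (in_fset_set fy) !in_setE /=.
  by move=> [AH y0]; split=> //; exact: sle_zero y0.
have [H [AH x0 y0]] := neq_sle_wall xy nxy.
apply/negP => /fsubsetP/(_ H); rewrite (in_fset_set fx) (in_fset_set fy) !in_setE /=.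
by move=> /(_ (conj AH x0))[].
Qed.

Lemma fcov_exists f k : sle f k -> ~ sgeq f k -> exists g, fcov f g.
Proof.
move=> fk nfk; have [m] := ubnP (wall_count f - wall_count k)%N.
elim: m k fk nfk => // m IH k fk nfk; rewrite ltnS => hm.
have [[x [fx xk nxf nxk]]|no] := pselect (exists x, [/\ sle f x, sle x k,
    ~ sgeq x f & ~ sgeq x k]); last first.
  exists k; split=> // x fx xk; apply: contrapT => /not_orP[nxf nxk].
  by apply: no; exists x.
have nfx : ~ sgeq f x by move/sgeq_sym.
apply: (IH x) => //; have := wall_count_lt xk nxk; have := wall_count_lt fx nfx; lia.
Qed.

End Thin.

(** * The cell poset of the Salvetti complex by signs *)

Section Cells.
Variables (R : realType) (n : nat) (A : set (set 'rV[R]_n)).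
Hypothesis hA : is_arrangement A.
Local Notation V := 'rV[R]_n.
Local Notation sle := (sle A).
Local Notation sgeq := (sgeq A).
Local Notation face := (face A).
Local Notation fcov := (fcov A).
Local Notation chamber_pt := (chamber_pt A).
Implicit Types (H : set V) (x y z f g h k : V) (p q r c : Sal A).

Lemma sg_cases H x : [\/ sg H x = 0, sg H x = 1 | sg H x = -1].
Proof. by rewrite /sg; case: (sgE (ev H x)) => -[_ ->]; [constructor 3|constructor 1|constructor 2]. Qed.

Lemma finite_faces (B : set (set V)) x : finite_set B ->
  finite_set [set F | exists2 y, F = face y & forall H, A H -> ~ B H -> sg H y = sg H x].
Proof.
move=> /finite_seqP[l ->]; elim: l x => [|K l IH] x.
  apply: (@sub_finite_set _ _ [set face x]); last exact: finite_set1.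
  by move=> F /= [y -> yx]; apply/face_eq => H AH; apply: yx.
pose T (s : R) := [set F | exists2 y, F = face y & sg K y = s /\
  forall H, A H -> ~ [set` K :: l] H -> sg H y = sg H x].
have fT s : finite_set (T s).
  (* The piece with sign [s] at [K] may not contain [x]; any of its points serves as the new base
     point for the induction. *)
  have [[y [ys yx]]|no] := pselect (exists y, sg K y = s /\
      forall H, A H -> ~ [set` K :: l] H -> sg H y = sg H x); last first.
    apply: (@sub_finite_set _ _ set0) => // F [y _ hy]; case: no; by exists y.
  apply: sub_finite_set (IH y) => F [z -> [zs zx]]; exists z => // H AH Hl.
  have [->|/eqP HK] := eqVneq H K; first by rewrite zs ys.
  have nKl : ~ [set` K :: l] H by rewrite /= inE => /predU1P[|].
  by rewrite zx // yx.
apply: (@sub_finite_set _ _ (T 0 `|` T 1 `|` T (-1))).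
  move=> F [y -> yx]; case: (sg_cases K y) => e; [left; left|left; right|right];
    by exists y.
by rewrite !finite_setU.
Qed.

Definition cp c : V := xget 0 [set x | cell_chamber c = face x].
Definition fp c : V := xget 0 [set x | cell_face c = face x].

Lemma cell_faceE c : cell_face c = face (fp c).
Proof.
have [_ /(is_faceP hA)[x cx] _] := set_valP c.
by apply: (@xgetPex _ 0 [set x | cell_face c = face x]); exists x.
Qed.

Lemma cell_chamberE c : cell_chamber c = face (cp c).
Proof.
have [[/(is_faceP hA)[x cx] _] _ _] := set_valP c.
by apply: (@xgetPex _ 0 [set x | cell_chamber c = face x]); exists x.
Qed.

Lemma cp_chamber c : chamber_pt (cp c).
Proof.
apply/(is_chamberE hA); rewrite -cell_chamberE.
by have [] := set_valP c.
Qed.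

Lemma fp_le c : sle (fp c) (cp c).
Proof.
apply/face_sub; rewrite -cell_chamberE -cell_faceE.
by have [] := set_valP c.
Qed.

Lemma cell_ext p q : sgeq (cp p) (cp q) -> sgeq (fp p) (fp q) -> p = q.
Proof.
move=> /face_eq ec /face_eq ef; apply: val_inj.
apply/eqP; rewrite /eq_op /=; apply/andP; split; apply/eqP.
  by have := ec; rewrite -!cell_chamberE.
by have := ef; rewrite -!cell_faceE.
Qed.

Lemma cell_ex d f : chamber_pt d -> sle f d ->
  exists c, sgeq (cp c) d /\ sgeq (fp c) f.
Proof.
move=> cd fd.
have h : Sal A (face d, face f).
  split=> /=; [exact/is_chamberE | by apply/(is_faceP hA); exists f | exact/face_sub].
exists (SigSub (mem_set h)).
split; apply/face_eq; first by rewrite -cell_chamberE.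
by rewrite -cell_faceE.
Qed.

Lemma cell_ltE q p : cell_lt q p <-> [/\ sle (fp p) (fp q), ~ sgeq (fp p) (fp q) &
  forall H, A H -> sg H (fp q) = 0 -> sg H (cp q) = sg H (cp p)].
Proof.
rewrite /cell_lt !cell_faceE !cell_chamberE (chamber_atE hA); last exact: cp_chamber.
split=> [[/face_sub pq npq /face_eq e]|[pq npq e]]; split=> //.
- by move/sgeq_sym/face_eq.
- by move=> H AH q0; rewrite -(e H AH) sg_at // q0 eqxx.
- exact/face_sub.
- by move/face_eq/sgeq_sym.
- apply/face_eq => H AH; rewrite sg_at //; case: eqVneq => h0; first by rewrite e.
  by rewrite (sle_nonzero (fp_le q)) //; exact/eqP.
Qed.

Lemma cell_lt_asym p q : cell_lt p q -> ~ cell_lt q p.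
Proof.
move=> /cell_ltE[qp nqp _] /cell_ltE[pq _ _]; apply: nqp; exact: sle_anti.
Qed.

Lemma fcov_sgeq f f' k k' : sgeq f f' -> sgeq k k' -> fcov f k -> fcov f' k'.
Proof.
move=> ff kk [fk nfk mid]; split.
- by apply: sle_trans (sle_trans (sgeq_sle (sgeq_sym ff)) fk) (sgeq_sle kk).
- by move=> e; apply: nfk; apply: sgeq_trans ff (sgeq_trans e (sgeq_sym kk)).
- move=> x f'x xk'.
  case: (mid x (sle_trans (sgeq_sle ff) f'x) (sle_trans xk' (sgeq_sle (sgeq_sym kk)))) => e.
    by left; exact: sgeq_trans ff.
  by right; exact: sgeq_trans kk.
Qed.

Local Notation covers := (covers (@cell_lt R n A)).

Lemma coversP p q : covers p q <-> fcov (fp p) (fp q) /\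
  forall H, A H -> sg H (fp q) = 0 -> sg H (cp q) = sg H (cp p).
Proof.
split=> [[/cell_ltE[pq npq e] no]|[[pq npq mid] e]]; split=> //.
- split=> // x px xq; apply: contrapT => /not_orP[nxp nxq]; apply: no.
  (* A face [x] strictly between lifts to the cell [<D.x, x>], with [D] the chamber of [p]. *)
  have [r [rc rf]] := cell_ex (at_chamber hA x (@cp_chamber p)) (sle_at hA (cp p) x).
  have rx := sgeq_sle rf; have xr := sgeq_sle (sgeq_sym rf).
  exists r; split; apply/cell_ltE; split.
  + exact: sle_trans rx xq.
  + by move=> rq; apply: nxq; apply: sgeq_trans (sgeq_sym rf) rq.
  + move=> H AH q0; rewrite rc // sg_at // (sle_zero xq) // eqxx.
    exact: e.
  + exact: sle_trans px xr.
  + by move=> pr; apply: nxp; apply: sgeq_sym; exact: sgeq_trans pr rf.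
  + by move=> H AH; rewrite rf // rc // sg_at // => ->; rewrite eqxx.
- exact/cell_ltE.
- move=> [r [/cell_ltE[rq nrq _] /cell_ltE[pr npr _]]].
  by case: (mid _ pr rq) => // /sgeq_sym.
Qed.

Lemma finite_cells (B : set (set V)) x : finite_set B ->
  finite_set [set c | forall H, A H -> ~ B H ->
    sg H (cp c) = sg H x /\ sg H (fp c) = sg H x].
Proof.
move=> fB; pose F := [set F | exists2 y, F = face y &
  forall H, A H -> ~ B H -> sg H y = sg H x].
have fF : finite_set (F `*` F) by apply: finite_setX; exact: finite_faces.
apply: (@sub_finite_set _ _ ((fun c : Sal A => val c) @^-1` (F `*` F))).
  move=> c hc; split.
    by exists (cp c); [exact: cell_chamberE | move=> H AH /(hc H AH)[]].
  by exists (fp c); [exact: cell_faceE | move=> H AH /(hc H AH)[]].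
by apply: finite_preimage fF => p q _ _; exact: val_inj.
Qed.

Lemma finite_covers p : finite_set [set q | covers p q].
Proof.
apply: sub_finite_set (finite_cells (fp p) (supp_finite hA (fp p))).
move=> q /= /coversP[[pq _ _] _] H AH nB.
have p0 : sg H (fp p) <> 0 by move=> p0; apply: nB.
have e := sle_nonzero pq AH p0; split=> //.
by rewrite (sle_nonzero (fp_le q)) // e.
Qed.

Definition lower p : seq (Sal A) := fset_set [set q | covers p q].

Lemma lower_uniq p : uniq (lower p).
Proof. exact: fset_uniq. Qed.

Lemma lowerP p q : q \in lower p <-> covers p q.
Proof.
by rewrite /lower (in_fset_set (finite_covers p)) in_setE.
Qed.

Lemma cell_thin p q r : covers p q -> covers q r ->
  exists q', [/\ q' <> q, covers p q' & covers q' r].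
Proof.
move=> /coversP[pq epq] /coversP[qr eqr].
have [g [pg gr ngq]] := fcov_thin hA pq qr.
have [q' [qc qf]] := cell_ex (at_chamber hA g (@cp_chamber p)) (sle_at hA (cp p) g).
have [gler _ _] := gr; have [qler _ _] := qr.
exists q'; split.
- by move=> e; apply: ngq; rewrite -e; exact: sgeq_sym.
- apply/coversP; split; first by apply: fcov_sgeq pg => //; exact: sgeq_sym.
  by move=> H AH; rewrite qf // qc // sg_at // => ->; rewrite eqxx.
- apply/coversP; split; first by apply: fcov_sgeq gr => //; exact: sgeq_sym.
  move=> H AH r0; rewrite qc // sg_at // (sle_zero gler) // eqxx.
  by rewrite eqr // epq // (sle_zero qler).
Qed.

End Cells.

(** * Cocycles attached to flats *)

Section Cocycles.
Variables (R : realType) (n : nat) (A : set (set 'rV[R]_n)).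
Hypothesis hA : is_arrangement A.
Local Notation V := 'rV[R]_n.
Local Notation sle := (sle A).
Local Notation sgeq := (sgeq A).
Local Notation face := (face A).
Local Notation fcov := (fcov A).
Local Notation chamber_pt := (chamber_pt A).
Local Notation covers := (covers (@cell_lt R n A)).
Implicit Types (H : set V) (x y z c f g h k : V) (p q r : Sal A).

Variable inc : Sal A -> Sal A -> int.
Hypothesis hinc : incidence_function (@cell_lt R n A) (@cell_dim R n A) inc.
Local Notation coboundary := (coboundary inc (@lower R n A)).

Lemma inc_unit p q : covers p q -> inc p q = 1 \/ inc p q = -1.
Proof. by case: hinc => _ h _ _; exact: h. Qed.

Lemma salvetti_coboundary2 w p : coboundary (coboundary w) p = 0.
Proof.
apply: coboundary2.
- exact: inc_unit.
- by case: hinc => _ _ _ h p' q q' r a b c d; exact: h.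
- exact: lower_uniq.
- exact: lowerP.
- exact: cell_thin.
Qed.

Lemma coboundary_neq0 w p : coboundary w p <> 0 ->
  exists q, covers p q /\ w q <> 0.
Proof.
move=> h; apply: contrapT => no; apply: h; rewrite /coboundary big_seq big1 // => q.
move=> /(lowerP hA) pq; have [->|/eqP wq] := eqVneq (w q) 0; first by rewrite mulr0.
by case: no; exists q.
Qed.

Lemma eq_coboundary w w' p : (forall q, covers p q -> w q = w' q) ->
  coboundary w p = coboundary w' p.
Proof.
move=> e; rewrite /coboundary big_seq [RHS]big_seq; apply: eq_bigr => q.
by move=> /(lowerP hA)/e ->.
Qed.

Lemma vertex_edge p q : covers p q -> chamber_pt (fp q) -> cell_dim p = 1%N.
Proof.
move=> /(coversP hA)[pq _] cq; have [leq neq _] := pq.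
have [H [AH p0 q0]] := neq_sle_wall leq neq.
rewrite /cell_dim (cell_faceE hA); apply: (codim_wall hA AH p0) => v H' AH' p0' v0.
by apply: (fcov_lin hA pq AH p0 q0 _ v0) => // H'' AH'' /eqP; rewrite (negPf (cq _ AH'')).
Qed.

(** An edge has a vertex [q] and the one obtained by reflecting [q] in the face of [p], with
    opposite incidence numbers. A third vertex would give three units with vanishing pairwise
    sums. *)
Lemma vertex_cocycle p :
  coboundary (fun q => if `[< chamber_pt (fp q) >] then 1 else 0) p = 0.
Proof.
have [[q [pq cq]]|no] := pselect (exists q, covers p q /\ chamber_pt (fp q)); last first.
  apply: contrapT => /coboundary_neq0[q [pq]]; case: asboolP => // cq _.
  by apply: no; exists q.
have d1 := vertex_edge pq cq; have [_ _ inc0 _] := hinc.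
have /(coversP hA)[fpq epq] := pq; have [hpq _ _] := fpq.
have [g [fpg ngq zg]] := fcov_reflect hA fpq.
have cg : chamber_pt g by move=> H AH; apply/eqP => /(zg H AH)/eqP; apply/negP/cq.
have [q' [q'c q'f]] := cell_ex hA (at_chamber hA g (@cp_chamber _ _ _ hA p)) (sle_at hA (cp p) g).
have q'ne : q <> q' by move=> e; apply: ngq; rewrite e; exact: sgeq_sym.
have pq' : covers p q'.
  apply/(coversP hA); split; first by apply: fcov_sgeq fpg => //; exact: sgeq_sym.
  by move=> H AH; rewrite q'f // q'c // sg_at // => ->; rewrite eqxx.
have cq' : chamber_pt (fp q') by move=> H AH; rewrite q'f //; exact: cg.
have e := inc0 p q q' d1 pq pq' q'ne.
have ql := (lowerP hA p q).2 pq; have q'l := (lowerP hA p q').2 pq'.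
have ul := @lower_uniq _ _ _ p.
rewrite /coboundary (perm_big _ (perm_to_rem ql)) /= big_cons asboolT // mulr1.
have q'rem : q' \in rem q (lower p).
  by rewrite mem_rem_uniq // inE q'l andbT; apply/eqP => /esym.
rewrite (perm_big _ (perm_to_rem q'rem)) /= big_cons asboolT // mulr1 addrA e add0r.
rewrite big_seq big1 // => x.
rewrite mem_rem_uniq ?rem_uniq // inE mem_rem_uniq // inE => /and3P[/eqP xq' /eqP xq].
move=> /(lowerP hA) px; case: asboolP => [cx|]; last by rewrite mulr0.
have e1 := inc0 p q x d1 pq px (nesym xq).
have e2 := inc0 p q' x d1 pq' px (nesym xq').
by case: (inc_unit pq) => h; lia.
Qed.

(* The cochain dual to all cells [<D, G>] where [G] spans the flat of [f] and
   [D] lies on the side of [c] of the hyperplanes containing it.  When [k]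
   covers [f], it is the coboundary of the restriction to a half-space of the
   cochain of [k], restricted to the cells on the right side. *)
Lemma flat_cocycle c f : chamber_pt c -> sle f c -> exists w : Sal A -> int,
  [/\ forall p, w p <> 0 -> (forall H, A H -> sg H (fp p) = 0 <-> sg H f = 0) /\
        forall H, A H -> sg H f = 0 -> sg H (cp p) = sg H c,
      forall p, sgeq (fp p) f -> sgeq (cp p) c -> w p <> 0
    & forall p, coboundary w p = 0].
Proof.
have [m] := ubnP (wall_count A f); elim: m c f => // m IH c f; rewrite ltnS => hm cc fc.
have [cf|ncf] := pselect (chamber_pt f).
  exists (fun q => if `[< chamber_pt (fp q) >] then 1 else 0); split.
  - move=> p; case: asboolP => // cfp _.
    have nf H : A H -> sg H f <> 0 by move=> AH; apply/eqP/cf.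
    have np H : A H -> sg H (fp p) <> 0 by move=> AH; apply/eqP/cfp.
    by split=> H AH; [split=> [/(np H AH)|/(nf H AH)] | move/(nf H AH)].
  - by move=> p pf _; rewrite asboolT // => H AH; rewrite pf //; exact: cf.
  - exact: vertex_cocycle.
have [k fk] : exists k, fcov f k.
  apply: fcov_exists fc _ => // e; apply: ncf => H AH.
  by rewrite e //; exact: cc.
have [lefk nfk _] := fk.
have [H1 [AH1 f1 k1]] := neq_sle_wall lefk nfk.
pose c' := at_pt A c k.
have [w [wsupp wtop wcoc]] : exists w : Sal A -> int,
  [/\ forall p, w p <> 0 -> (forall H, A H -> sg H (fp p) = 0 <-> sg H k = 0) /\
        forall H, A H -> sg H k = 0 -> sg H (cp p) = sg H c',
      forall p, sgeq (fp p) k -> sgeq (cp p) c' -> w p <> 0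
    & forall p, coboundary w p = 0].
  apply: IH; [|exact: at_chamber|exact: sle_at].
  exact: leq_trans (wall_count_lt hA lefk nfk) hm.
pose t q := if sg H1 (fp q) == sg H1 k then w q else 0.
have tsupp p : coboundary t p <> 0 ->
    forall H, A H -> sg H (fp p) = 0 <-> sg H f = 0.
  move=> tp; have [q [pq]] := coboundary_neq0 tp.
  rewrite /t; case: eqVneq => // q1 /wsupp[qk _].
  have /(coversP hA)[fpq _] := pq; have [lepq _ _] := fpq.
  (* If [p] were off [H1], all cells covered by [p] would be on the side of [k], where [t] is [w],
     and the cocycle [w] would give 0. *)
  have p1 : sg H1 (fp p) = 0.
    apply: contrapT => p1; apply: tp; rewrite -[RHS](wcoc p).
    apply: eq_coboundary => q' /(coversP hA)[[lepq' _ _] _].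
    by rewrite /t (sle_nonzero lepq') // -(sle_nonzero lepq) // q1 eqxx.
  apply: (fcov_same_flat hA fk fpq _ AH1 k1 f1 p1) => H AH.
  by split=> /(qk H AH).
pose side p := forall H, A H -> sg H f = 0 -> sg H (cp p) = sg H c.
exists (fun p => if `[< side p >] then coboundary t p else 0); split.
- by move=> p; case: asboolP => // sp /tsupp.
- move=> p pf pc; rewrite asboolT; last by move=> H AH _; exact: pc.
  have [q [qc qk]] := cell_ex hA (at_chamber hA k cc) (sle_at hA c k).
  have pq : covers p q.
    apply/(coversP hA); split.
      by apply: fcov_sgeq fk; exact: sgeq_sym.
    by move=> H AH; rewrite qk // qc // sg_at // => ->; rewrite eqxx pc.
  rewrite /coboundary (bigD1_seq q) ?lower_uniq //=; last exact/(lowerP hA).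
  rewrite big_seq_cond big1 ?addr0.
    rewrite /t qk // eqxx; have := wtop q qk qc.
    by case: (inc_unit pq) => -> wq; lia.
  (* A contributing cell has the flat of [k] and lies on its side of [H1], so its face is that of
     [k]; its chamber is then determined by [p]. Hence only [q] contributes. *)
  move=> q' /andP[/(lowerP hA) pq' /eqP q'q]; rewrite /t; case: eqVneq => q'1;
    last by rewrite mulr0.
  have [->|/eqP/wsupp[q'k _]] := eqVneq (w q') 0; first by rewrite mulr0.
  have /(coversP hA)[fpq' epq'] := pq'.
  have ff : fcov f (fp q') by apply: fcov_sgeq fpq'.
  have q'ke : sgeq (fp q') k.
    by apply: (fcov_facet_uniq hA fk ff _ AH1) => // H AH; split=> /(q'k H AH).
  case: q'q; apply: cell_ext => // H AH; rewrite ?q'ke ?qk //.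
  rewrite qc // sg_at //; case: eqVneq => [k0|/eqP k0].
    by rewrite epq' ?pc // q'ke.
  by rewrite (sle_nonzero (fp_le hA q')) ?q'ke.
(* A covered cell [q] on which the coboundary of [t] is nonzero has the flat of [f], so [side] holds
   for [q] if and only if it holds for [p]. The restricted cochain thus has either the same
   coboundary at [p] as the unrestricted one, or coboundary 0. *)
- move=> p; have [sp|nsp] := pselect (side p).
    rewrite -[RHS](salvetti_coboundary2 t p); apply: eq_coboundary => q.
    move=> /(coversP hA)[_ epq]; case: asboolP => // nsq.
    apply/esym; apply: contrapT => /tsupp qf; apply: nsq => H AH f0.
    by rewrite epq ?sp // qf.
  rewrite -[RHS](_ : coboundary (fun=> 0) p = 0); last first.
    by rewrite /coboundary big1 // => q _; rewrite mulr0.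
  apply: eq_coboundary => q /(coversP hA)[_ epq]; case: asboolP => // sq.
  apply: contrapT => /tsupp qf; apply: nsp => H AH f0.
  by rewrite -epq ?sq // qf.
Qed.

End Cocycles.

(** * Nearest points, and hyperplanes near the base point *)

Section Nearest.
Variables (R : realType) (n : nat) (A : set (set 'rV[R]_n)).
Hypothesis hA : is_arrangement A.
Local Notation V := 'rV[R]_n.
Local Notation sle := (sle A).
Local Notation sgeq := (sgeq A).
Local Notation face := (face A).
Local Notation chamber_pt := (chamber_pt A).
Implicit Types (H : set V) (x y z c f g h k : V).
Variable x0 : V.

Definition sqdist z : R := dotp (x0 - z) (x0 - z).

Definition box (s : R) : set V :=
  [set v : V | forall i, v ord0 i \in `[x0 ord0 i - s, x0 ord0 i + s]].

Lemma box_compact s : compact (box s).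
Proof.
apply: (@rV_compact _ _ (fun i => `[x0 ord0 i - s, x0 ord0 i + s]%classic)).
by move=> i; apply: segment_compact.
Qed.

(** Here [s] is a squared radius, and [s + 1] bounds its root because [s <= (s + 1) ^ 2]. *)
Lemma ball_box s z : 0 <= s -> sqdist z <= s -> box (s + 1) z.
Proof.
move=> s0 hz i; rewrite in_itv /=.
have := dotp_coord_le (x0 - z) i; rewrite !mxE => h.
have {h}h := le_trans h hz.
have : `|x0 ord0 i - z ord0 i| <= s + 1.
  rewrite -(ler_pXn2r (n := 2)) ?nnegrE ?addr_ge0 // real_normK ?num_real //.
  by apply: le_trans h _; nra.
rewrite ler_norml => /andP[h1 h2]; apply/andP; split; lra.
Qed.

Definition near_walls (s : R) : set (set V) :=
  [set H | A H /\ exists2 z, H z & sqdist z <= s].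

Lemma near_walls_finite s : 0 <= s -> finite_set (near_walls s).
Proof.
move=> s0; have := @box_compact (s + 1); rewrite compact_cover.
have [U hU] : {U : V -> set V & forall x, nbhs x (U x) /\
    finite_set [set H | A H /\ H `&` U x !=set0]}.
  by apply: (@choice _ _ (fun x U => nbhs x U /\
    finite_set [set H | A H /\ H `&` U !=set0])) => x;
    have [U] := hA.2 x; exists U.
move=> /(_ _ setT (fun x => (U x)^°)) [||D' _ hD'].
- by move=> x _; exact: open_interior.
- by move=> x _; exists x => //; apply: (hU x).1.
apply: (@sub_finite_set _ _ (\bigcup_(x in [set` D']) [set H | A H /\ H `&` U x !=set0])).
  move=> H [AH [z Hz hz]]; have [x Dx Uz] := hD' z (ball_box s0 hz).
  by exists x => //; split=> //; exists z; split=> //; exact: interior_subset.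
by apply: bigcup_finite => // x _; exact: (hU x).2.
Qed.

Lemma sqdist_ray t z : sqdist (x0 + t *: (z - x0)) = t ^+ 2 * sqdist z.
Proof.
rewrite /sqdist opprD addNKr -scalerN opprB dotpZl dotpZr; ring.
Qed.

(** The segment from [x0] to [z] stays in the ball, so a hyperplane with different signs at its ends
    meets the ball. *)
Lemma sg_ball s z H : sqdist z <= s -> A H -> ~ near_walls s H -> sg H z = sg H x0.
Proof.
move=> hz AH nH; apply: contrapT => /nesym/(sg_segment hA AH)[t /andP[t0 t1] Ht].
apply: nH; split=> //; exists (x0 + t *: (z - x0)) => //.
rewrite sqdist_ray; apply: le_trans hz; rewrite ler_piMl ?dotp_ge0 //.
by rewrite expr_le1.
Qed.

Lemma edistE z : Defs.edist x0 z = Num.sqrt (sqdist z).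
Proof. by []. Qed.

Lemma edist_le y z : (Defs.edist x0 y <= Defs.edist x0 z) = (sqdist y <= sqdist z).
Proof. by rewrite !edistE ler_sqrt // dotp_ge0. Qed.

Lemma eprojP c : face c (eproj (face c) x0) /\
  forall z, face c z -> Defs.edist x0 (eproj (face c) x0) <= Defs.edist x0 z.
Proof.
apply: (@xgetPex _ point [set y | face c y /\
  forall z, face c z -> Defs.edist x0 y <= Defs.edist x0 z]).
pose K := face c `&` [set z | sqdist z <= sqdist c].
have clK : closed K.
  apply: closedI; first by rewrite -closure_stratum //; exact: closed_closure.
  apply: (@preimage_closed V R sqdist [set r | r <= sqdist c]); last exact: closed_le.
  by move=> z _; exact: sqdist_continuous.
have cK : compact K.
  apply: (subclosed_compact clK (@box_compact (sqdist c + 1))) => z [_].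
  by apply: ball_box; exact: dotp_ge0.
have K0 : K !=set0 by exists c; split=> //=; exact: sle_refl.
have [y] := EVT_min_rV K0 cK (continuous_subspaceT (@sqdist_continuous R n x0)).
rewrite in_setE => -[yc _] ymin; exists y; split=> // z cz.
rewrite edist_le; have [zc|/ltW cz'] := leP (sqdist z) (sqdist c).
  by apply: ymin; rewrite in_setE.
by apply: le_trans cz'; apply: ymin; rewrite in_setE; split=> //=; exact: sle_refl.
Qed.

Lemma edist_setE c : edist_set x0 (face c) = Defs.edist x0 (eproj (face c) x0).
Proof.
have [cy ymin] := eprojP c; set y := eproj _ _ in cy ymin *.
apply/eqP; rewrite eq_le; apply/andP; split.
  apply: ge_inf; last by exists y.
  by exists 0 => _ [z _ <-]; exact: sqrtr_ge0.
apply: lb_le_inf; first by exists (Defs.edist x0 y), y.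
by move=> _ [z cz <-]; exact: ymin.
Qed.

Lemma sqdist_diff y z :
  sqdist z = sqdist y - 2 * dotp (x0 - y) (z - y) + dotp (z - y) (z - y).
Proof.
rewrite /sqdist; have -> : x0 - z = (x0 - y) - (z - y) by rewrite opprB addrA subrK.
move: (x0 - y) (z - y) => u v.
rewrite dotpBl !dotpBr (dotpC v u); ring.
Qed.

(* [x0 - y] lies in the normal cone at [y], which depends only on the
   hyperplanes through [y]. *)
Lemma eproj_obtuse c z : let y := eproj (face c) x0 in
  (forall H, A H -> sg H y = 0 -> sg H z = 0 \/ sg H z = sg H c) ->
  dotp (x0 - y) (z - y) <= 0.
Proof.
move=> y hz; have [cy ymin] := eprojP c; rewrite -/y in cy ymin.
have [d d0 hd] := sg_ray hA y (z - y).
rewrite leNgt; apply/negP; set p := dotp _ _ => p0.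
pose q := dotp (z - y) (z - y); have q0 : 0 <= q by exact: dotp_ge0.
(* [t <= d] keeps the moved point in the face, and [t * (q + 1) <= p] makes the change
   [- 2 * t * p + t ^ 2 * q] of the squared distance negative. *)
pose t := Num.min d (p / (q + 1)).
have t0 : 0 < t by rewrite lt_min d0 divr_gt0 // ltr_wpDl.
have td : t <= d by rewrite ge_min lexx.
have tp : t * (q + 1) <= p by rewrite -ler_pdivlMr ?ltr_wpDl // ge_min lexx orbT.
have ct : face c (y + t *: (z - y)).
  move=> H AH; rewrite hd //; case: eqVneq => [y0|ny0]; last exact: cy.
  by rewrite (sg_diff z AH y0); exact: hz.
have := ymin _ ct; rewrite edist_le (sqdist_diff y (y + t *: (z - y))).
rewrite [y + _]addrC addrK dotpZr dotpZl dotpZr -/p -/q; nra.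
Qed.

Lemma eproj_cone c c' : let y := eproj (face c) x0 in
  (forall H, A H -> sg H y = 0 -> sg H c' = sg H c) ->
  edist_set x0 (face c) <= edist_set x0 (face c').
Proof.
move=> y hc; rewrite !edist_setE edist_le -/y.
have [cy' _] := eprojP c'; set y' := eproj (face c') x0 in cy' *.
have : dotp (x0 - y) (y' - y) <= 0.
  apply: eproj_obtuse => H AH y0; rewrite -(hc H AH y0); exact: cy'.
by rewrite (sqdist_diff y y') => h; have := dotp_ge0 (y' - y); lra.
Qed.

(** Genericity settles the case of equal distances: the nearest point [y] then lies in both
    chambers, which therefore agree also on the hyperplanes missing [y]. A strict inequality decides
    the order. *)
Lemma euclidean_order_cone ord c c' : euclidean_order A x0 ord ->
  chamber_pt c -> chamber_pt c' ->
  (forall H, A H -> sg H (eproj (face c) x0) = 0 -> sg H c' = sg H c) ->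
  sgeq c' c \/ ord (face c) (face c').
Proof.
move=> [[irr trans tot] [gen _] ordle] cc cc' hc.
have fc : is_chamber A (face c) by exact/is_chamberE.
have fc' : is_chamber A (face c') by exact/is_chamberE.
have le := eproj_cone hc.
have [e|ne] := eqVneq (edist_set x0 (face c)) (edist_set x0 (face c')).
  left; have [_ [cy c'y]] := gen _ _ fc fc' e.
  move=> H AH; set y := eproj _ _ in hc cy c'y.
  have [y0|y0] := pselect (sg H y = 0); first exact: hc.
  by rewrite (sle_nonzero c'y) // (sle_nonzero cy).
have [/face_eq/sgeq_sym cc''|ncc] := pselect (face c = face c'); first by left.
case: (tot _ _ fc fc' ncc) => [|o]; first by right.
by exfalso; have := ordle _ _ fc' fc o; rewrite leNgt lt_neqAle ne le.
Qed.

Lemma nearest_faceE c : nearest_face A x0 (face c) = face (eproj (face c) x0).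
Proof.
have [cy _] := eprojP c; set y := eproj _ _ in cy *.
have Ymin G : is_face A G -> G y -> face y `<=` G.
  by move=> /(is_faceP hA)[g ->] yg; exact/face_sub.
have fy : is_face A (face y) by apply/(is_faceP hA); exists y.
rewrite /nearest_face -/y; apply: get_unique.
  split=> //; [exact/face_sub | exact: sle_refl | by move=> G fG _; exact: Ymin].
move=> F [fF Fc Fy Fmin]; apply/seteqP; split; last exact: Ymin.
by apply: Fmin => //; [exact/face_sub | exact: sle_refl].
Qed.

(** The nearest point [y] may lie on walls of the chamber; the slack in [s + 1] leaves room to move
    from [y] towards [c], to a point with exactly the signs of [c]. *)
Lemma near_chamber s c : edist_set x0 (face c) <= Num.sqrt s -> 0 <= s ->
  forall H, A H -> ~ near_walls (s + 1) H -> sg H c = sg H x0.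
Proof.
rewrite edist_setE => hy s0; have [cy _] := eprojP c; set y := eproj _ _ in hy cy.
have hy1 : sqdist y < s + 1.
  by apply: le_lt_trans (_ : s < s + 1); [rewrite -(ler_sqrt _ s0) | rewrite ltrDl].
have Ny := @cvgr_lt _ _ _ (nbhs_filter y) _ _ (@sqdist_continuous R n x0 y) _ hy1.
have [d d0 hd] := nbhs_ray (c - y) Ny.
pose t := Num.min d 1.
have t0 : 0 < t by rewrite lt_min d0 ltr01.
have hz := hd t (ltW t0) (_ : t <= d).
move=> H AH nH; rewrite -(sg_segment_face cy (t := t) _ AH).
  by apply: sg_ball nH => //; apply/ltW/hz; rewrite ge_min lexx.
by rewrite t0 ge_min lexx orbT.
Qed.

End Nearest.

(** * Euclidean matchings: monotonicity, finiteness and triangularity *)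

Section EuclideanMatchings.
Variables (R : realType) (n : nat) (A : set (set 'rV[R]_n)).
Hypothesis hA : is_arrangement A.
Local Notation V := 'rV[R]_n.
Local Notation sle := (sle A).
Local Notation sgeq := (sgeq A).
Local Notation face := (face A).
Local Notation chamber_pt := (chamber_pt A).
Implicit Types (H C : set V) (x y z f g h k : V) (p q r t c : Sal A).

Variables (x0 : V) (ord : set V -> set V -> Prop).
Hypothesis hord : euclidean_order A x0 ord.

Lemma ord_irr C : is_chamber A C -> ~ ord C C.
Proof. by case: hord => -[h _ _] _ _; exact: h. Qed.

Lemma ord_trans C D E : is_chamber A C -> is_chamber A D -> is_chamber A E ->
  ord C D -> ord D E -> ord C E.
Proof. by case: hord => -[_ h _] _ _; exact: h. Qed.

Lemma is_chamberP C : is_chamber A C <-> exists2 x, C = face x & chamber_pt x.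
Proof.
split=> [cC|[x -> cx]]; last exact/is_chamberE.
have [/(is_faceP hA)[x Cx] _] := cC; exists x => //.
by apply/(is_chamberE hA); rewrite -Cx.
Qed.

Lemma ord_near C0 s : is_chamber A C0 -> 0 <= s -> sqdist x0 (eproj C0 x0) <= s ->
  forall x, chamber_pt x -> face x = C0 \/ ord (face x) C0 ->
  forall H, A H -> ~ near_walls A x0 (s + 1) H -> sg H x = sg H x0.
Proof.
move=> cC0 s0 hs x cx xC0; apply: near_chamber => //.
apply: (@le_trans _ _ (edist_set x0 C0)).
  case: xC0 => [->//|]; case: hord => _ _; apply=> //; exact/is_chamberE.
have /is_chamberP[c0 cE _] := cC0; rewrite cE edist_setE // edistE -cE.
exact: ler_wsqrtr.
Qed.

Lemma finite_ord_below C0 : is_chamber A C0 ->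
  finite_set [set C | is_chamber A C /\ (C = C0 \/ ord C C0)].
Proof.
move=> cC0; have s0 : 0 <= sqdist x0 (eproj C0 x0) by exact: dotp_ge0.
have fB := near_walls_finite hA x0 (addr_ge0 s0 ler01).
apply: sub_finite_set (finite_faces A x0 fB) => C [/is_chamberP[x -> cx] xC0].
by exists x => //; exact: ord_near xC0.
Qed.

Lemma SalSE x p : chamber_pt x -> SalS (face x) p <->
  forall H, A H -> sg H (fp p) = 0 -> sg H x = sg H (cp p).
Proof.
move=> cx; rewrite /SalS /= (cell_faceE hA) (cell_chamberE hA) (chamber_atE hA) //.
split=> [/face_eq e H AH p0|e].
  by rewrite e // sg_at // p0 eqxx.
apply/face_eq => H AH; rewrite sg_at //; case: eqVneq => [p0|/eqP p0].
  by rewrite e.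
by rewrite (sle_nonzero (fp_le hA p)).
Qed.

Lemma seq_minimal (l : seq (set V)) C : (forall D, D \in l -> is_chamber A D) ->
  C \in l -> exists2 D, D \in l & forall D', D' \in l -> ~ ord D' D.
Proof.
elim: l C => // a l IH C hl _.
have [[b bl]|no] := pselect (exists b, b \in l); last first.
  exists a; rewrite ?mem_head // => D'; rewrite inE => /predU1P[->|D'l].
    by apply: ord_irr; apply: hl; rewrite mem_head.
  by case: no; exists D'.
have hl' D : D \in l -> is_chamber A D by move=> Dl; apply: hl; rewrite inE Dl orbT.
have [D Dl Dmin] := IH b hl' bl.
have ca : is_chamber A a by apply: hl; rewrite mem_head.
have [aD|naD] := pselect (ord a D).
  exists a; rewrite ?mem_head // => D'; rewrite inE => /predU1P[->|D'l].
    exact: ord_irr.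
  by move=> D'a; apply: (Dmin D' D'l); apply: ord_trans aD => //; exact: hl'.
by exists D; [rewrite inE Dl orbT | move=> D'; rewrite inE => /predU1P[->|/Dmin]].
Qed.

Definition home p : set V := get [set C | is_chamber A C /\ SalN ord C p].

(** A minimal chamber exists because only finitely many precede the chamber of [p]: their distances
    to [x0] are bounded. *)
Lemma homeP p : is_chamber A (home p) /\ SalN ord (home p) p.
Proof.
apply: (@xgetPex _ point [set C | is_chamber A C /\ SalN ord C p]).
have cp0 : is_chamber A (face (cp p)) by apply/is_chamberE => //; exact: cp_chamber.
pose X := [set C | is_chamber A C /\ (C = face (cp p) \/ ord C (face (cp p)))]
  `&` [set C | SalS C p].
have fX : finite_set X by apply: finite_setIl; exact: finite_ord_below.
have Xp : X (face (cp p)).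
  by split; [split=> //; left | apply/SalSE => //; exact: cp_chamber].
have /finite_seqP[l lE] := fX.
have inl C : C \in l <-> X C by rewrite lE.
have [C Cl Cmin] := @seq_minimal l (face (cp p)) (fun D Dl => ((inl D).1 Dl).1.1)
  ((inl _).2 Xp).
have [[cC Cle] SC] := (inl C).1 Cl.
exists C; split=> //; split=> // C' cC' C'C SC'; apply: (Cmin C') => //.
apply/inl; split=> //; split=> //; right.
by case: Cle => [<-//|]; exact: ord_trans C'C.
Qed.

Lemma home_min p C : is_chamber A C -> SalS C p -> home p = C \/ ord (home p) C.
Proof.
move=> cC SC; have [ch [_ hmin]] := homeP p.
have [->|/eqP ne] := eqVneq (home p) C; first by left.
case: hord => -[_ _ tot] _ _; case: (tot _ _ ch cC ne) => [|o]; first by right.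
by case: (hmin C cC o).
Qed.

Definition hp p : V := xget 0 [set x | home p = face x].

Lemma homeE p : home p = face (hp p).
Proof.
have [/is_chamberP[x hx _] _] := homeP p.
by apply: (@xgetPex _ 0 [set x | home p = face x]); exists x.
Qed.

Lemma hp_chamber p : chamber_pt (hp p).
Proof. by apply/(is_chamberE hA); rewrite -homeE; have [] := homeP p. Qed.

Lemma sg_hp p H : A H -> sg H (fp p) = 0 -> sg H (hp p) = sg H (cp p).
Proof.
have [_ [+ _]] := homeP p; rewrite homeE => /(SalSE _ (@hp_chamber p)); exact.
Qed.

Definition op p : V := opp_pt A (cp p) (fp p).

(** On a hyperplane containing the face, the home chamber is on the side of [cp p] and [op p] is on
    the other one. *)
Lemma sg_op_eq p H : A H -> sg H (op p) = sg H (hp p) ->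
  sg H (fp p) <> 0 /\ sg H (fp p) = sg H (hp p).
Proof.
move=> AH; rewrite sg_opp //; case: eqVneq => [p0|/eqP p0 //].
rewrite sg_hp // => /eqP; rewrite -subr_eq0 -opprD oppr_eq0 -mulr2n mulrn_eq0 /=.
by rewrite (negPf (cp_chamber hA p AH)).
Qed.

Lemma etaE p : eta ord p = (home p, face (op p)).
Proof.
rewrite /eta (cell_chamberE hA) (cell_faceE hA) opp_chamberE //.
  exact: cp_chamber.
exact: fp_le.
Qed.

Variable M : set (Sal A * Sal A).
Hypothesis acM : acyclic_matching (@cell_lt R n A) M.
Hypothesis homM : homogeneous (eta ord) M.
Hypothesis critM : forall c : Sal A,
  critical M c <-> cell_face c = nearest_face A x0 (cell_chamber c).

Local Notation E := (matching_graph (@cell_lt R n A) M).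

(** Matched edges preserve [eta]. Along a downward edge the home of [p] still has [q] in its [S], so
    the home of [q] is not later. The second part says that [op q] is below [op p] in the order
    based at the home of [p], in terms of complements of separating sets. *)
Lemma edge_mono p q : E p q -> (home q = home p \/ ord (home q) (home p)) /\
  forall H, A H -> sg H (op p) = sg H (hp p) -> sg H (op q) = sg H (hp p).
Proof.
case/asboolP => -[cov Mpq].
  have /(coversP hA)[[pq _ _] epq] := cov; split.
    have [ch _] := homeP p; apply: home_min => //; rewrite homeE.
    apply/SalSE; first exact: hp_chamber.
    by move=> H AH q0; rewrite sg_hp // ?epq //; exact: sle_zero pq AH q0.
  move=> H AH /(sg_op_eq AH)[p0 <-]; rewrite sg_opp // (sle_nonzero pq) //.
  by case: eqP => // /p0.
have := homM Mpq; rewrite !etaE => -[hE /face_eq oE].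
by split=> [|H AH]; [left | rewrite oE].
Qed.

(** The order on opposite chambers depends on the home chamber, so it composes along a path only
    while the home stays constant. *)
Lemma reachable_mono p q : reachable E p q ->
  (home q = home p \/ ord (home q) (home p)) /\
  (home q = home p -> forall H, A H -> sg H (op p) = sg H (hp p) ->
     sg H (op q) = sg H (hp p)).
Proof.
move=> [s ps <-]; elim: s p ps => [|p1 s IH] p /=; first by split=> //; left.
move=> /andP[/edge_mono[h1 o1] /IH[h2 o2]]; set q' := last p1 s in h2 o2 *.
have [cq _] := homeP q'; have [cp1 _] := homeP p1; have [cp' _] := homeP p.
split.
  case: h2 => [->//|h2]; case: h1 => [<-|h1]; right => //.
  exact: ord_trans h2 h1.
move=> qp; have p1p : home p1 = home p.
  case: h1 => // h1; case: h2 => [<-//|h2]; exfalso; apply: (ord_irr cp').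
  by rewrite -{1}qp; exact: ord_trans h2 h1.
have hpE : hp p1 = hp p by rewrite /hp p1p.
move=> H AH /(o1 H AH); rewrite -hpE; apply: o2 => //.
by rewrite qp p1p.
Qed.

(** Let [B] be the hyperplanes near [x0] on the scale of the home and the opposite chamber of [p].
    Outside [B] all later homes have the signs of [x0], so the opposite chambers keep these signs
    even when the home changes. Then [sg_op_eq] fixes both face and chamber outside the finite set
    [B]. *)
Lemma reachable_finite p : finite_set (reachable E p).
Proof.
have [ch _] := homeP p.
pose s := Num.max (sqdist x0 (eproj (home p) x0)) (sqdist x0 (eproj (face (op p)) x0)).
have s0 : 0 <= s by rewrite le_max dotp_ge0.
have fB := near_walls_finite hA x0 (addr_ge0 s0 ler01).
set B := near_walls _ _ _ in fB.
have hB q : home q = home p \/ ord (home q) (home p) ->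
    forall H, A H -> ~ B H -> sg H (hp q) = sg H x0.
  move=> hq; apply: (ord_near ch s0).
  - by rewrite le_max lexx.
  - exact: hp_chamber.
  - by rewrite -homeE.
pose I q := (home q = home p \/ ord (home q) (home p)) /\
  forall H, A H -> ~ B H -> sg H (op q) = sg H x0.
have Ip : I p.
  split; first by left.
  apply: near_chamber => //; rewrite edist_setE // edistE ler_wsqrtr //.
  by rewrite le_max lexx orbT.
have Iedge q q' : I q -> E q q' -> I q'.
  move=> [hq oq] /edge_mono[hq' oq']; split.
    have [cq _] := homeP q; have [cq' _] := homeP q'.
    case: hq' => [->//|hq']; right; case: hq => [<-//|]; exact: ord_trans hq'.
  move=> H AH nB; rewrite (oq' H AH) ?(hB q hq H AH nB) //.
  by rewrite oq.
have Ireach q : reachable E p q -> I q.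
  move=> [u pu <-]; elim: u (p) Ip pu => //= a u IH b Ib /andP[ba]; apply: IH.
  exact: Iedge ba.
apply: sub_finite_set (finite_cells hA x0 fB) => q /Ireach[hq oq] H AH nB.
have [q0 e] : sg H (fp q) <> 0 /\ sg H (fp q) = sg H (hp q).
  by apply: sg_op_eq => //; rewrite oq // hB.
by rewrite -(hB q hq H AH nB) -e (sle_nonzero (fp_le hA q)).
Qed.

Lemma critical_fp p : critical M p -> sgeq (fp p) (eproj (face (cp p)) x0).
Proof.
move/critM; rewrite (cell_faceE hA) (cell_chamberE hA) nearest_faceE //.
by move/face_eq.
Qed.

(** The home agrees with the chamber of [p] on all hyperplanes through its nearest point, so it
    equals that chamber or comes later; minimality excludes the latter. *)
Lemma critical_home p : critical M p -> home p = face (cp p).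
Proof.
move=> crp; have cc := @cp_chamber _ _ _ hA p.
have chp := @hp_chamber p.
case: (euclidean_order_cone hA hord cc chp) => [H AH y0|/face_eq e|o].
- by apply: sg_hp => //; rewrite (critical_fp crp).
- by rewrite homeE.
- have [_ [_ hmin]] := homeP p; exfalso; apply: (hmin (face (cp p))).
  + exact/is_chamberE.
  + by rewrite homeE.
  + exact/SalSE.
Qed.

Variable inc : Sal A -> Sal A -> int.
Hypothesis hinc : incidence_function (@cell_lt R n A) (@cell_dim R n A) inc.

(** The support of [w] puts the home of [c] in the cone of [t], hence not before the home of [t],
    while reachability puts it not after the home of [t']. If all three homes coincide then
    [t' = t], since a critical cell is determined by its chamber. *)
Lemma critical_triangular t t' c (w : Sal A -> int) :
  (forall p, w p <> 0 -> (forall H, A H -> sg H (fp p) = 0 <-> sg H (fp t) = 0) /\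
     forall H, A H -> sg H (fp t) = 0 -> sg H (cp p) = sg H (cp t)) ->
  critical M t -> critical M t' -> reachable E t' c -> w c <> 0 ->
  (c = t' /\ t' = t) \/ ord (home t) (home t').
Proof.
move=> hw ct ct' rc /hw[fc cc].
have [r1 r2] := reachable_mono rc.
have [ht _] := homeP t; have [ht' _] := homeP t'; have [hc _] := homeP c.
have : home c = home t \/ ord (home t) (home c).
  rewrite (critical_home ct) [home c]homeE.
  case: (euclidean_order_cone hA hord (@cp_chamber _ _ _ hA t) (@hp_chamber c)).
  - move=> H AH y0; have t0 : sg H (fp t) = 0 by rewrite (critical_fp ct).
    by rewrite sg_hp ?cc //; apply/fc.
  - by move/face_eq => ->; left.
  - by right.
case=> [ctE|tc]; last first.
  by right; case: r1 => [<-//|]; exact: ord_trans.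
case: r1 => [cE|]; last by rewrite ctE; right.
left; have t't : t' = t.
  have cpE : face (cp t') = face (cp t).
    by rewrite -(critical_home ct) -(critical_home ct') -ctE.
  apply: cell_ext => //; first exact/face_eq.
  apply: sgeq_trans (critical_fp ct') _; rewrite cpE.
  exact/sgeq_sym/critical_fp.
(* Off the face of [t], its home and opposite chamber agree, so monotonicity gives [op c] the same
   signs there and determines the face and chamber of [c]. On the remaining hyperplanes the support
   condition does so. *)
split=> //; subst t'; have o := r2 cE.
have chp H : A H -> sg H (hp t) = sg H (cp t).
  by move=> AH; apply: (face_eq A _ _).1 AH; rewrite -homeE critical_home.
have off H : A H -> sg H (fp t) <> 0 ->
    sg H (fp c) = sg H (fp t) /\ sg H (cp c) = sg H (cp t).
  move=> AH t0; have tE : sg H (op t) = sg H (hp t).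
    rewrite sg_opp // chp // (sle_nonzero (fp_le hA t)) //.
    by case: eqP => // /t0.
  have c0 : sg H (fp c) <> 0 by move/(fc H AH).
  have := o H AH tE; rewrite sg_opp //; case: eqP => // _.
  rewrite chp // (sle_nonzero (fp_le hA t)) // => fE; split=> //.
  by rewrite (sle_nonzero (fp_le hA c)) // fE (sle_nonzero (fp_le hA t)).
apply: cell_ext => // H AH; have [t0|t0] := pselect (sg H (fp t) = 0).
- exact: cc.
- by case: (off H AH t0).
- by rewrite t0; apply/fc.
- by case: (off H AH t0).
Qed.

Lemma euclidean_incidence_vanish sigma tau : critical M sigma -> critical M tau ->
  morse_incidence (@cell_lt R n A) inc M sigma tau = 0.
Proof.
have [W hW] : {W : Sal A -> Sal A -> int & forall t,
  [/\ forall p, W t p <> 0 -> (forall H, A H -> sg H (fp p) = 0 <-> sg H (fp t) = 0) /\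
        forall H, A H -> sg H (fp t) = 0 -> sg H (cp p) = sg H (cp t),
      forall p, sgeq (fp p) (fp t) -> sgeq (cp p) (cp t) -> W t p <> 0
    & forall p, coboundary inc (@lower R n A) (W t) p = 0]}.
  apply: (@choice _ _ (fun (t : Sal A) (w : Sal A -> int) => [/\ forall p, w p <> 0 ->
      (forall H, A H -> sg H (fp p) = 0 <-> sg H (fp t) = 0) /\
      forall H, A H -> sg H (fp t) = 0 -> sg H (cp p) = sg H (cp t),
    forall p, sgeq (fp p) (fp t) -> sgeq (cp p) (cp t) -> w p <> 0
    & forall p, coboundary inc (@lower R n A) w p = 0])) => t.
  exact: flat_cocycle (@cp_chamber _ _ _ hA t) (fp_le hA t).
apply: (morse_incidence_vanish (low := @lower R n A) _ _ _ _ _ _ _ _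
  (prec := fun p q => ord (home p) (home q)) (W := W)).
- exact: cell_lt_asym.
- exact: acM.
- by move=> p q; exact: inc_unit.
- by case: hinc => _ _ _ h p q q' r a b c d; exact: h.
- exact: lower_uniq.
- exact: lowerP.
- exact: cell_thin.
- exact: reachable_finite.
- by move=> p; apply: ord_irr; have [] := homeP p.
- move=> p q r _ _ _; apply: ord_trans;
    [have [] := homeP p | have [] := homeP q | have [] := homeP r]; done.
- by move=> t _; case: (hW t).
- by move=> t _; case: (hW t) => _ h _; apply/eqP; apply: h.
- move=> t t' c ct ct' rc /eqP; case: (hW t) => h _ _.
  exact: critical_triangular.
Qed.

End EuclideanMatchings.

Theorem theorem5p13 (R : realType) (n : nat) (A : set (set 'rV[R]_n))
    (hA : is_arrangement A) (x0 : 'rV[R]_n) (M : set (Sal A * Sal A))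
    (hM : euclidean_matching x0 M)
    (inc : Sal A -> Sal A -> int)
    (hinc : incidence_function (@cell_lt R n A) (@cell_dim R n A) inc) :
  minimal_morse_complex (@cell_lt R n A) (@cell_dim R n A) inc M.
Proof.
have [acM _ [ord hord homM] critM] := hM.
move=> sigma tau cs ct _; split.
  have fin := acyclic_paths_finite acM.2 (reachable_finite hA hord homM) sigma.
  by apply: sub_finite_set fin => s [].
exact: (euclidean_incidence_vanish hA hord acM homM critM hinc).
Qed.
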